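(* Let $P$ be an infinite countable set and $N:P\to\mathbb{R}_{>1}$ a map such that $\sum_{p\in P}N(p)^{-d}<\infty$ for some $d>0$, normalized so that $\inf\{d>0 : \sum_{p\in P}N(p)^{-d}<\infty\}=1$. Define $$\zeta_P(s):=\prod_{p\in P}(1-N(p)^{-s})^{-1}\quad(\Re s>1),$$ and assume (i) $\zeta_P(s)$ is non-zero holomorphic in $\{\Re s>1\}$ and has a simple pole at $s=1$, and (ii) $\zeta_P(s)$ has a meromorphic continuation to all of $\mathbb{C}$. Let $G$ be a cyclic group of prime order $q$, let $\hat G$ be the set of irreducible unitary representations of $G$, and let $\varphi:P\to\mathrm{Conj}(G)$ be a map. For $\rho\in\hat G$ put $$L_P(s,\rho):=\prod_{p\in P}\det\big(1-\rho(\varphi(p))N(p)^{-s}\big)^{-1}\quad(\Re s>1),$$ and assume that for every $\rho\neq 1$, $L_P(s,\rho)$ is non-zero holomorphic in $\{\Re s\geq 1\}$ and has a meromorphic continuation to all of $\mathbb{C}$. Put $Z_P(s):=\prod_{\rho\in\hat G}L_P(s,\rho)^{\dim\rho}$, $P_q:=\{p\in P : \varphi(p)\text{ has order } q \text{ in } G\}$ and $$\zeta_{P_q}(s):=\prod_{p\in P_q}(1-N(p)^{-s})^{-1}\quad(\Re s>1).$$ Then $$\frac{\big(\zeta_{P_q}(s)\big)^q}{\zeta_{P_q}(qs)}=\frac{\big(\zeta_P(s)\big)^q}{Z_P(s)}.$$ Furthermore, for every integer $r\geq 1$, the function $\big(\zeta_{P_q}(s)\big)^{q^r}$ has an analytic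 continuation to $\{\Re s>1/q^r\}$ as a meromorphic function, and (the continuations so obtained of) $\zeta_{P_q}(s)$ have infinitely many singular points near $s=0$.
   Context: The order of a conjugacy class is the order of any of its elements. $\mathrm{Conj}(G)$ denotes the set of conjugacy classes of $G$; $\det(1-\rho(\varphi(p))N(p)^{-s})$ is independent of the representative of the class $\varphi(p)$. *)

(* Defs.v *)
From HB Require Import structures.
From mathcomp Require Import all_boot all_order all_algebra all_fingroup.
From mathcomp Require Import all_solvable all_field all_character.
From mathcomp Require Import finmap complex.
From mathcomp Require Import all_classical all_reals all_analysis.
From mathcomp.analysis.showcase Require Import summability.

Set Implicit Arguments.
Unset Strict Implicit.
Unset Printing Implicit Defensive.

Import Order.TTheory GRing.Theory Num.Theory.
Import numFieldNormedType.Exports.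

Local Open Scope classical_set_scope.
Local Open Scope ring_scope.

(* R[i] packaged as a numClosedFieldType, so that its modulus topology and its
   structure of normed module over itself are the canonical ones. *)
Definition Cplx (R : realType) : numClosedFieldType := R[i].

Section ComplexAnalysis.
Variable R : realType.
Local Notation C := (Cplx R).

Definition expC (z : C) : C :=
  Complex (expR (complex.Re z) * cos (complex.Im z))
          (expR (complex.Re z) * sin (complex.Im z)).

Definition cpow (x : R) (s : C) : C := expC (s * Complex (ln x) 0).

Definition re_gt (a : R) : set C := [set s | a < complex.Re s].
Definition re_ge (a : R) : set C := [set s | a <= complex.Re s].

(* Derivatives are taken over the scalar field C: this is complex
   differentiability on a neighbourhood of a. *)
Definition holomorphic_at (f : C -> C) (a : C) : Prop :=
  \forall z \near a, derivable f z 1.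

Definition holomorphic_on (D : set C) (f : C -> C) : Prop :=
  forall a, D a -> holomorphic_at f a.

Definition nonvanishing_on (D : set C) (f : C -> C) : Prop :=
  forall a, D a -> f a != 0.

Definition pole_of_order (n : nat) (f : C -> C) (a : C) : Prop :=
  (0 < n)%N /\
  exists h : C -> C, [/\ holomorphic_at h a, h a != 0 &
    \forall z \near a^', f z = h z / (z - a) ^+ n].

Definition simple_pole (f : C -> C) (a : C) : Prop := pole_of_order 1 f a.

(* The value that f takes at a pole is irrelevant. *)
Definition meromorphic_on (D : set C) (f : C -> C) : Prop :=
  forall a, D a -> holomorphic_at f a \/ exists n, pole_of_order n f a.

Definition meromorphic_continuation (U V : set C) (f g : C -> C) : Prop :=
  [/\ U `<=` V, meromorphic_on V g & forall s, U s -> g s = f s].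

End ComplexAnalysis.

Section Representations.
Variables (R : realType) (gT : finGroupType) (G : {group gT}).
Local Notation C := (Cplx R).

Definition unitary_repr (n : nat) (rG : mx_representation C G n) : Prop :=
  forall g, g \in G -> rG g \is unitarymx.

Definition trivial_repr (n : nat) (rG : mx_representation C G n) : Prop :=
  n = 1%N /\ forall g, g \in G -> rG g = 1%:M.

(* The irreducible unitary representations of G up to equivalence, given by a
   complete and irredundant system of representatives. *)
Record unitary_dual := UnitaryDual {
  udual :> finType;
  udim : udual -> nat;
  urepr : forall i : udual, mx_representation C G (udim i);
  urepr_unitary : forall i, unitary_repr (urepr i);
  urepr_irr : forall i, mx_irreducible (urepr i);
  urepr_inj : forall i j, mx_rsim (urepr i) (urepr j) -> i = j;
  urepr_complete : forall n (rG : mx_representation C G n),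
    unitary_repr rG -> mx_irreducible rG -> exists i, mx_rsim rG (urepr i)
}.

Definition Conj := {c : {set gT} | c \in classes G}.

Definition class_order (c : Conj) : nat := #[repr (val c)]%g.

Lemma unitary_dual_inhabited : inhabited unitary_dual.
Proof.
pose sG : irrType C G := DecSocleType (regular_repr C G).
have C'G : (([pchar C]^').-group G)%g.
  by apply/pgroupP => p _; rewrite inE /= pchar_num.
pose Q (i : sG) := exists n (rG : mx_representation C G n),
  [/\ unitary_repr rG, mx_irreducible rG & mx_rsim rG (irr_repr i)].
pose T : finType := {i : sG | `[< Q i >]}.
have QT (t : T) : {n : nat & {rG : mx_representation C G n |
    [/\ unitary_repr rG, mx_irreducible rG & mx_rsim rG (irr_repr (val t))]}}.
  have /asboolP/cid[n /cid[rG rGP]] := valP t.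
  by exists n, rG.
have uT t := svalP (projT2 (QT t)).
constructor; apply: (@UnitaryDual T (fun t => projT1 (QT t))
                                    (fun t => sval (projT2 (QT t)))).
- by move=> t; case: (uT t).
- by move=> t; case: (uT t).
- move=> t u tu; apply/val_inj/eqP/socle_rsimP.
  have [_ _ tP] := uT t; have [_ _ uP] := uT u.
  exact: mx_rsim_trans (mx_rsim_trans (mx_rsim_sym tP) tu) uP.
- move=> n rG rGu rGi; have rGs := rsim_irr_comp_pchar sG C'G rGi.
  have Qi : `[< Q (irr_comp sG rG) >] by apply/asboolP; exists n, rG.
  pose t : T := exist (fun i => `[< Q i >]) _ Qi.
  by exists t; have [_ _ /mx_rsim_sym] := uT t; apply: mx_rsim_trans.
Qed.

End Representations.

Section EulerProducts.
Variables (R : realType) (P : countType) (N : P -> R).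
Local Notation C := (Cplx R).

(* unconditional product over A: limit along the finite subsets of P ordered by
   inclusion *)
Definition uprod (A : set P) (F : P -> C) : C :=
  lim ((fun J : {fset P} => \prod_(p <- J | p \in A) F p) @ totally).

Definition zetaP (A : set P) (s : C) : C :=
  uprod A (fun p => (1 - cpow (N p) (- s))^-1).

Variables (gT : finGroupType) (G : {group gT}) (phi : P -> Conj G).

Definition LP (n : nat) (rG : mx_representation C G n) (s : C) : C :=
  uprod [set: P] (fun p =>
    (\det (1%:M - cpow (N p) (- s) *: rG (repr (val (phi p)))))^-1).

Definition ZP (Ghat : unitary_dual R G) (s : C) : C :=
  \prod_(i : Ghat) LP (urepr i) s ^+ udim i.

Definition Pord (m : nat) : set P := [set p | class_order (phi p) = m].

End EulerProducts.

(* M r stands for the continuation of f ^ (q ^ r) to Re s > 1 / q ^ r, so that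
   the local branches at s of the continuation of f are the (q ^ r)-th roots of
   M r near s.  The point s is regular when some branch is holomorphic at s;
   poles and branch points are singular. *)
Definition singular_point (R : realType) (q : nat)
    (M : nat -> Cplx R -> Cplx R) (s : Cplx R) : Prop :=
  0 < complex.Re s /\
  forall r : nat, (1 <= r)%N -> re_gt ((q ^ r)%:R^-1) s ->
    ~ exists g : Cplx R -> Cplx R, holomorphic_at g s /\
        \forall z \near s^', g z ^+ (q ^ r) = M r z.

(* Main.v *)
Require Import Defs.
From HB Require Import structures.
From mathcomp Require Import all_boot all_order all_algebra all_fingroup.
From mathcomp Require Import all_solvable all_field all_character.
From mathcomp Require Import finmap complex.
From mathcomp Require Import all_classical all_reals all_analysis.
From mathcomp.analysis.showcase Require Import summability.
From mathcomp Require Import ring lra.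

(** Let F be the meromorphic function (zeta_P)^q / Z_P. The identity, proved
    factor by factor from prod_chi (1 - chi(g) X) = 1 - X^q for g of order q,
    reads zeta_q(s)^q = F(s) zeta_q(qs); iterating it continues
    zeta_q(s)^(q^(r+1)) = F(s)^(q^r) zeta_q(qs)^(q^r) one strip further to the
    left at each step.  At s = 1, F has a pole of order q - 1, so the order of
    the continuation of zeta_q^(q^r) at q^-k (k < r) is not divisible by
    q^(r-k), whatever the orders of F at the points q^-j are.  Hence it is not
    a q^r-th power there, and every q^-k is a singular point.

    Order of a zero, and uniqueness of the continuations, rest on the local
    theory of complex differentiable functions.  Goursat's theorem for the
    periodic function f(e^w) makes the integral of f over circles centred at 0
    independent of the radius, which gives the Cauchy formula for functions
    that are continuous on a disc and differentiable off its centre, hence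
    removable singularities, Cauchy's estimate and Weierstrass' theorem. *)

Set Implicit Arguments.
Unset Strict Implicit.
Unset Printing Implicit Defensive.

Import Order.TTheory GRing.Theory Num.Theory.
Import numFieldNormedType.Exports.

Local Open Scope classical_set_scope.
Local Open Scope ring_scope.

#[local] Existing Instance totally_filter.

(** * Modulus and differentiability *)

Section Modulus.
Variable R : realType.
Local Notation C := (Cplx R).
Local Notation Re := (@complex.Re R).
Local Notation Im := (@complex.Im R).

(** The obstacle is that [zeta_q] cannot be continued meromorphically to a neighbourhood of 1, so it
    has no order at q^-k to be computed. Only its powers do, with an exponent that grows from strip
    to strip; hence the bookkeeping modulo powers of q. Functions are total, with 0^-1 = 0 and
    arbitrary values at poles, so a product or quotient formed pointwise may be wrong at isolated
    points. Local statements therefore live on punctured neighbourhoods, and values are repaired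
    only when a continuation is exhibited. The identity principle serves twice: it gives F an order
    at every point, and it shows that an arbitrary family of continuations agrees with the
    constructed one, so that singularity does not depend on the choice. No power series occur: a
    Cauchy estimate for the successive quotients of f by z - a, all on one fixed disc, shows that a
    zero of infinite order forces f to vanish near a. *)

Definition nrm (z : C) : R := Num.sqrt (Re z ^+ 2 + Im z ^+ 2).

Definition ofR (x : R) : C := Complex x 0.

(** The norm of [Cplx R] has its values in [Cplx R], whose order is partial. Through this identity
    all estimates are made with the real number [nrm z]. *)
Lemma normE (z : C) : `|z| = ofR (nrm z).
Proof. exact: normc_def. Qed.

Lemma ofRD x y : ofR (x + y) = ofR x + ofR y.
Proof. by rewrite /ofR /= -[Complex (x + y) 0]/(real_complex R _) rmorphD. Qed.
Lemma ofRM x y : ofR (x * y) = ofR x * ofR y.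
Proof. by rewrite /ofR /= -[Complex (x * y) 0]/(real_complex R _) rmorphM. Qed.
Lemma ofRN x : ofR (- x) = - ofR x.
Proof. by rewrite /ofR /= -[Complex (- x) 0]/(real_complex R _) rmorphN. Qed.
Lemma ofRV x : ofR x^-1 = (ofR x)^-1.
Proof. exact: (fmorphV (real_complex R)). Qed.
Lemma ofR_nat n : ofR n%:R = n%:R.
Proof. exact: (rmorph_nat (real_complex R)). Qed.
Lemma ofR_inj : injective ofR.
Proof. by move=> x y []. Qed.
Lemma le_ofR x y : (ofR x <= ofR y) = (x <= y).
Proof. exact: lecR. Qed.
Lemma lt_ofR x y : (ofR x < ofR y) = (x < y).
Proof. exact: ltcR. Qed.

(** Positive elements of [C] are real, so balls of [C] have real radii. *)
Lemma gt0_ofR (e : C) : 0 < e -> exists2 d : R, 0 < d & e = ofR d.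
Proof.
case: e => a b; rewrite ltcE /= => /andP[/eqP -> a0].
by exists a.
Qed.

Lemma nrm_ge0 z : 0 <= nrm z.
Proof. exact: sqrtr_ge0. Qed.

Lemma nrmM z w : nrm (z * w) = nrm z * nrm w.
Proof. by apply: ofR_inj; rewrite ofRM -!normE normrM. Qed.

Lemma nrmD z w : nrm (z + w) <= nrm z + nrm w.
Proof. by rewrite -le_ofR ofRD -!normE ler_normD. Qed.

Lemma nrmN z : nrm (- z) = nrm z.
Proof. by apply: ofR_inj; rewrite -!normE normrN. Qed.

Lemma nrmB z w : nrm (z - w) = nrm (w - z).
Proof. by rewrite -nrmN opprB. Qed.

Lemma nrmBD y z w : nrm (z - w) <= nrm (z - y) + nrm (y - w).
Proof. by apply: le_trans (nrmD _ _); rewrite addrA subrK. Qed.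

Lemma nrmV z : nrm z^-1 = (nrm z)^-1.
Proof. by apply: ofR_inj; rewrite ofRV -!normE normfV. Qed.

Lemma nrmX z n : nrm (z ^+ n) = nrm z ^+ n.
Proof.
elim: n => [|n IH]; last by rewrite !exprS nrmM IH.
by rewrite !expr0 /nrm /= expr0n addr0 expr1n sqrtr1.
Qed.

Lemma nrm0 : nrm 0 = 0.
Proof. by apply: ofR_inj; rewrite -normE normr0. Qed.

Lemma nrm1 : nrm 1 = 1.
Proof. by rewrite -[1 in LHS](expr0 1) nrmX. Qed.

Lemma nrm_eq0 z : (nrm z == 0) = (z == 0).
Proof. by rewrite -(inj_eq ofR_inj) -normE normr_eq0. Qed.

Lemma nrm_gt0 z : (0 < nrm z) = (z != 0).
Proof. by rewrite lt_def nrm_ge0 andbT nrm_eq0. Qed.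

Lemma nrm_ofR x : nrm (ofR x) = `|x|.
Proof. by rewrite /nrm /= expr0n addr0 sqrtr_sqr. Qed.

Lemma le_Re_nrm z : `|Re z| <= nrm z.
Proof. by rewrite -sqrtr_sqr ler_wsqrtr// lerDl sqr_ge0. Qed.

Lemma le_Im_nrm z : `|Im z| <= nrm z.
Proof. by rewrite -sqrtr_sqr ler_wsqrtr// lerDr sqr_ge0. Qed.

Lemma nrm_le z : nrm z <= `|Re z| + `|Im z|.
Proof.
rewrite -[leRHS]ger0_norm ?addr_ge0// -[leRHS]sqrtr_sqr ler_wsqrtr//.
rewrite sqrrD !real_normK ?num_real// lerD2r lerDl mulrn_wge0//.
Qed.

Lemma nrm_complex x y : nrm (Complex x y) <= `|x| + `|y|.
Proof. exact: nrm_le. Qed.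

Lemma cReD z w : Re (z + w) = Re z + Re w. Proof. by case: z; case: w. Qed.
Lemma cImD z w : Im (z + w) = Im z + Im w. Proof. by case: z; case: w. Qed.
Lemma cReN z : Re (- z) = - Re z. Proof. by case: z. Qed.
Lemma cImN z : Im (- z) = - Im z. Proof. by case: z. Qed.
Lemma cReM z w : Re (z * w) = Re z * Re w - Im z * Im w.
Proof. by case: z; case: w. Qed.
Lemma cImM z w : Im (z * w) = Re z * Im w + Im z * Re w.
Proof. by case: z; case: w. Qed.
Lemma complex_ext z w : Re z = Re w -> Im z = Im w -> z = w.
Proof. by case: z => a b; case: w => c d /= -> ->. Qed.

Lemma nbhsCP (z : C) (A : set C) :
  nbhs z A <-> exists2 d : R, 0 < d & forall w, nrm (w - z) < d -> A w.
Proof.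
split=> [/nbhs_ballP[e /= /gt0_ofR[d d0 ->] H]|[d d0 H]].
  by exists d => // w wz; apply: H; rewrite /ball /= normE lt_ofR nrmB.
apply/nbhs_ballP; exists (ofR d) => /=; first by rewrite -[0]/(ofR 0) lt_ofR.
by move=> w; rewrite /ball /= normE lt_ofR nrmB; apply: H.
Qed.

Lemma dnbhsCP (z : C) (A : set C) : (\forall w \near z^', A w) <->
  exists2 d : R, 0 < d & forall w, w != z -> nrm (w - z) < d -> A w.
Proof.
split=> [/nbhsCP[d d0 H]|[d d0 H]].
  by exists d => // w wz /H; apply.
by apply/nbhsCP; exists d => // w wd wz; apply: H.
Qed.

Lemma cvgCP T (F : set_system T) {FF : Filter F} (f : T -> C) (l : C) :
  f @ F --> l <-> forall e : R, 0 < e -> \forall x \near F, nrm (f x - l) < e.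
Proof.
split=> [H e e0|H].
  have := H [set w | nrm (w - l) < e]; apply; apply/nbhsCP.
  by exists e.
move=> A /nbhsCP[d d0 Hd]; have := H d d0.
by apply: filterS => x /Hd.
Qed.

Lemma continuousCP (f : C -> C) (z : C) : {for z, continuous f} <->
  forall e : R, 0 < e -> exists2 d : R, 0 < d &
    forall w, nrm (w - z) < d -> nrm (f w - f z) < e.
Proof.
have zF : Filter (nbhs z) by exact: nbhs_filter.
split=> [/(@cvgCP _ _ _ _ _) H e e0|H].
  exact: (nbhsCP _ _).1 (H e e0).
apply/(@cvgCP _ _ _ _ _) => e /H He; exact: (nbhsCP _ _).2 He.
Qed.

(** Caratheodory's criterion: [phi] is the difference quotient, completed at [z] by the derivative.
    It reduces the chain rule and the division by [z - a] to algebra and the continuity of [phi]. *)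
Lemma derivableCP (f : C -> C) (z : C) : derivable f z 1 <->
  exists phi : C -> C, {for z, continuous phi} /\
    forall w, f w - f z = phi w * (w - z).
Proof.
have zF : Filter ((0 : C)^') by exact: dnbhs_filter.
split=> [/cvg_ex[l /(@cvgCP _ _ _ _ _) H]|[phi [cphi H]]].
  exists (fun w => if w == z then l else (f w - f z) / (w - z)); split.
    apply/continuousCP => e e0; have /dnbhsCP[d d0 Hd] := H e e0.
    exists d => // w wd.
    rewrite eqxx; case: eqP => [_|/eqP wz]; first by rewrite subrr nrm0; lra.
    have := Hd (w - z); rewrite subr_eq0 subr0 => /(_ wz wd).
    by rewrite /= scaler1 /shift subrK [_ *: _]mulrC.
  move=> w; case: eqP => [->|/eqP wz]; first by rewrite !subrr mulr0.
  by rewrite divfK ?subr_eq0.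
apply/cvg_ex; exists (phi z); apply/(@cvgCP _ _ _ _ _) => e e0.
have /continuousCP/(_ e e0)[d d0 Hd] := cphi.
apply/dnbhsCP; exists d => // h h0; rewrite subr0 => hd /=.
rewrite H scaler1 /shift addrK [_ *: _]mulrC mulfK//.
by apply: Hd; rewrite addrK.
Qed.

(** The first-order estimate, written without a quotient so that it also covers [w = z]; Goursat's
    theorem uses it in this form. *)
Lemma derivable_lip (f : C -> C) (z : C) : derivable f z 1 <->
  exists l : C, forall e : R, 0 < e -> exists2 d : R, 0 < d &
    forall w, nrm (w - z) < d ->
      nrm (f w - f z - l * (w - z)) <= e * nrm (w - z).
Proof.
split=> [/derivableCP[phi [/continuousCP cphi H]]|[l H]].
  exists (phi z) => e /cphi[d d0 Hd]; exists d => // w /Hd we.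
  by rewrite H -mulrBl nrmM ler_wpM2r ?nrm_ge0// ltW.
have zF : Filter ((0 : C)^') by exact: dnbhs_filter.
apply/cvg_ex; exists l; apply/(@cvgCP _ _ _ _ _) => e e0.
have e2 : 0 < e / 2 by lra.
have [d d0 Hd] := H _ e2; apply/dnbhsCP; exists d => // h h0.
rewrite subr0 => hd /=; rewrite scaler1 /shift [_ *: _]mulrC.
have := Hd (h + z); rewrite addrK => /(_ hd) hh.
have -> : (f (h + z) - f z) / h - l = (f (h + z) - f z - l * h) / h.
  by rewrite [RHS]mulrBl mulfK.
rewrite nrmM nrmV ltr_pdivrMr ?nrm_gt0//; apply: le_lt_trans hh _.
by rewrite ltr_pM2r ?nrm_gt0//; lra.
Qed.

Lemma derivable_continuousC (f : C -> C) z :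
  derivable f z 1 -> {for z, continuous f}.
Proof. by move/derivable1_diffP/differentiable_continuous. Qed.

Lemma near_eq_derivableC (f g : C -> C) z :
  (\forall w \near z, f w = g w) -> derivable f z 1 -> derivable g z 1.
Proof.
move=> /[dup] fg /nbhs_singleton fgz /derivable_lip[l Hl].
apply/derivable_lip; exists l => e /Hl[d d0 Hd].
have /nbhsCP[d' d'0 Hd'] := fg.
exists (Num.min d d'); first by rewrite lt_min d0.
move=> w; rewrite lt_min => /andP[wd wd'].
by rewrite -fgz -Hd'//; apply: Hd.
Qed.

End Modulus.

(** * Integrals over segments *)

Section SegmentIntegral.
Variable R : realType.
Local Notation C := (Cplx R).
Local Notation Re := (@complex.Re R).
Local Notation Im := (@complex.Im R).
Local Notation mu := (@lebesgue_measure R).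

Definition cint (a b : R) (f : R -> C) : C :=
  Complex (\int[mu]_(t in `[a, b]) Re (f t)) (\int[mu]_(t in `[a, b]) Im (f t)).

(** Continuity within the whole line, end points included: the integrands are restrictions of
    functions continuous at points of [C], so no subspace topology is involved. *)
Definition cont_seg (a b : R) (f : R -> C) :=
  forall t, a <= t <= b -> {for t, continuous f}.

Lemma continuousRCP (f : R -> C) (t : R) : {for t, continuous f} <->
  forall e : R, 0 < e -> \forall u \near t, nrm (f u - f t) < e.
Proof.
have tF : Filter (nbhs t) by exact: nbhs_filter.
split=> [/(@cvgCP R _ _ _ _ _) H e e0|H]; first exact: H.
by apply/(@cvgCP R _ _ _ _ _) => e /H.
Qed.

Lemma continuous_ReC (f : R -> C) (t : R) :
  {for t, continuous f} -> {for t, continuous (Re \o f)}.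
Proof.
move=> /continuousRCP H; apply/cvgrPdist_lt => e e0.
have := H e e0; apply: filterS => u; apply: le_lt_trans => /=.
by rewrite distrC -cReN -cReD le_Re_nrm.
Qed.

Lemma continuous_ImC (f : R -> C) (t : R) :
  {for t, continuous f} -> {for t, continuous (Im \o f)}.
Proof.
move=> /continuousRCP H; apply/cvgrPdist_lt => e e0.
have := H e e0; apply: filterS => u; apply: le_lt_trans => /=.
by rewrite distrC -cImN -cImD le_Im_nrm.
Qed.

Lemma seg_integrable a b (f : R -> R) :
  (forall t, a <= t <= b -> {for t, continuous f}) ->
  mu.-integrable `[a, b] (EFin \o f).
Proof.
move=> H; apply: continuous_compact_integrable; first exact: segment_compact.
apply: continuous_in_subspaceT => t; rewrite inE /= in_itv /=.
exact: H.
Qed.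

Lemma integrable_Re a b f : cont_seg a b f ->
  mu.-integrable `[a, b] (EFin \o (fun t => Re (f t))).
Proof. by move=> H; apply: seg_integrable => t /H/continuous_ReC. Qed.

Lemma integrable_Im a b f : cont_seg a b f ->
  mu.-integrable `[a, b] (EFin \o (fun t => Im (f t))).
Proof. by move=> H; apply: seg_integrable => t /H/continuous_ImC. Qed.

Lemma cont_segD a b f g : cont_seg a b f -> cont_seg a b g ->
  cont_seg a b (fun t => f t + g t).
Proof. by move=> Hf Hg t tab; apply: cvgD; [exact: Hf|exact: Hg]. Qed.

Lemma cont_segM a b f g : cont_seg a b f -> cont_seg a b g ->
  cont_seg a b (fun t => f t * g t).
Proof. by move=> Hf Hg t tab; apply: cvgM; [exact: Hf|exact: Hg]. Qed.

Lemma cont_seg_cst a b (c : C) : cont_seg a b (fun=> c).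
Proof. by move=> t _; exact: cst_continuous. Qed.

Lemma cont_segZ a b c f : cont_seg a b f -> cont_seg a b (fun t => c * f t).
Proof. by move=> Hf; exact: (cont_segM (cont_seg_cst (c := c)) Hf). Qed.

Lemma cont_segN a b f : cont_seg a b f -> cont_seg a b (fun t => - f t).
Proof. by move=> Hf t tab; apply: cvgN; exact: Hf. Qed.

Lemma cont_segB a b f g : cont_seg a b f -> cont_seg a b g ->
  cont_seg a b (fun t => f t - g t).
Proof. by move=> Hf Hg; exact: (cont_segD Hf (cont_segN Hg)). Qed.

Lemma eq_cint a b f g : (forall t, a <= t <= b -> f t = g t) ->
  cint a b f = cint a b g.
Proof.
by move=> fg; congr Complex; apply: eq_Rintegral => t; rewrite inE /= in_itv /=
  => /fg ->.
Qed.

Lemma cintD a b f g : cont_seg a b f -> cont_seg a b g ->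
  cint a b (fun t => f t + g t) = cint a b f + cint a b g.
Proof.
move=> Hf Hg; apply: complex_ext; rewrite ?cReD ?cImD /=.
  under eq_Rintegral do rewrite cReD.
  by rewrite RintegralD//; exact: integrable_Re.
under eq_Rintegral do rewrite cImD.
by rewrite RintegralD//; exact: integrable_Im.
Qed.

Lemma cintZ a b c f : cont_seg a b f ->
  cint a b (fun t => c * f t) = c * cint a b f.
Proof.
move=> Hf; have iR := integrable_Re Hf; have iI := integrable_Im Hf.
have iZ r (g : R -> R) : (forall t, a <= t <= b -> {for t, continuous g}) ->
    mu.-integrable `[a, b] (EFin \o (fun t => r * g t)).
  by move=> cg; apply: seg_integrable => t /cg ct; apply: cvgM => //; exact: cvg_cst.
have cR t : a <= t <= b -> {for t, continuous (Re \o f)}.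
  by move=> /Hf/continuous_ReC.
have cI t : a <= t <= b -> {for t, continuous (Im \o f)}.
  by move=> /Hf/continuous_ImC.
apply: complex_ext; rewrite ?cReM ?cImM /=.
  under eq_Rintegral do rewrite cReM.
  by rewrite RintegralB ?RintegralZl//; [exact: (iZ _ _ cR)|exact: (iZ _ _ cI)].
under eq_Rintegral do rewrite cImM.
by rewrite RintegralD ?RintegralZl//; [exact: (iZ _ _ cI)|exact: (iZ _ _ cR)].
Qed.

Lemma cintN a b f : cont_seg a b f -> cint a b (fun t => - f t) = - cint a b f.
Proof.
move=> Hf; rewrite -mulN1r -cintZ//.
by apply: eq_cint => t _; rewrite mulN1r.
Qed.

Lemma cintB a b f g : cont_seg a b f -> cont_seg a b g ->
  cint a b (fun t => f t - g t) = cint a b f - cint a b g.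
Proof. by move=> Hf Hg; rewrite (cintD Hf (cont_segN Hg)) cintN. Qed.

Lemma Rintegral_seg_cst a b (r : R) : a <= b ->
  \int[mu]_(t in `[a, b]) r = r * (b - a).
Proof.
move=> ab; rewrite Rintegral_cst; last exact: measurable_itv.
congr (_ * _); apply: (etrans (congr1 fine (lebesgue_measure_itv `[a, b]))).
rewrite /= lte_fin.
by move: ab; rewrite le_eqVlt => /predU1P[->|->] //=; rewrite ltxx subrr.
Qed.

Lemma cint_cst a b c : a <= b -> cint a b (fun=> c) = ofR (b - a) * c.
Proof.
by move=> ab; apply: complex_ext; rewrite ?cReM ?cImM /= Rintegral_seg_cst//; ring.
Qed.

Lemma cint_split a m b f : a <= m <= b -> cont_seg a b f ->
  cint a b f = cint a m f + cint m b f.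
Proof.
move=> /andP[am mb] Hf.
have Hr g : mu.-integrable `[a, b] (EFin \o g) ->
    \int[mu]_(t in `[a, b]) g t =
    \int[mu]_(t in `[a, m]) g t + \int[mu]_(t in `[m, b]) g t.
  move=> ig; have := @Rintegral_itvB R g (BLeft a) (BRight b) m ig.
  rewrite !bnd_simp => /(_ am mb) E.
  (* The difference of the first two integrals is over []m, b]]; the point [m] has measure zero. *)
  rewrite -[X in _ + X]Rintegral_itv_obnd_cbnd; first by rewrite -E addrC subrK.
  apply: (integrableS _ _ _ ig) => //; apply: subset_itvr.
  by rewrite bnd_simp.
apply: complex_ext; rewrite ?cReD ?cImD /=; apply: Hr; [exact: integrable_Re|].
exact: integrable_Im.
Qed.

(* The factor 2 is not sharp: real and imaginary parts are bounded separately. *)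
Lemma cint_bound a b M f : a <= b -> cont_seg a b f ->
  (forall t, a <= t <= b -> nrm (f t) <= M) ->
  nrm (cint a b f) <= 2 * M * (b - a).
Proof.
move=> ab Hf HM; apply: le_trans (nrm_complex _ _) _.
have Hr g : (forall t, a <= t <= b -> {for t, continuous g}) ->
    (forall t, a <= t <= b -> `|g t| <= M) ->
    `|\int[mu]_(t in `[a, b]) g t| <= M * (b - a).
  move=> cg bg; have ig := seg_integrable cg.
  apply: le_trans (le_normr_Rintegral _ _) _ => //.
  apply: (@le_trans _ _ (\int[mu]_(t in `[a, b]) M)).
    apply: le_Rintegral => //.
    - by apply: seg_integrable => t /cg ?; exact: (continuous_comp _ (@norm_continuous _ _ _)).
    - by apply: seg_integrable => t _; exact: cst_continuous.
  by rewrite (Rintegral_seg_cst M ab) lexx.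
have -> : 2 * M * (b - a) = M * (b - a) + M * (b - a) by ring.
apply: lerD; apply: Hr.
- by move=> t /Hf/continuous_ReC.
- by move=> t /HM; apply: le_trans; exact: le_Re_nrm.
- by move=> t /Hf/continuous_ImC.
- by move=> t /HM; apply: le_trans; exact: le_Im_nrm.
Qed.

End SegmentIntegral.

(** * Goursat's theorem *)

Section Goursat.
Variable R : realType.
Local Notation C := (Cplx R).
Local Notation Re := (@complex.Re R).
Local Notation Im := (@complex.Im R).
Local Notation iC := (Complex 0 1 : C).
Implicit Types g : C -> C.

Lemma complexB (a b c d : R) :
  Complex a b - Complex c d = Complex (a - c) (b - d) :> C.
Proof. by []. Qed.

Lemma nrm_Complex0 (y : R) : nrm (Complex 0 y) = `|y|.
Proof. by rewrite /nrm /= expr0n add0r sqrtr_sqr. Qed.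

Lemma continuous_hline (g : C -> C) (x y : R) : {for Complex x y, continuous g} ->
  {for x, continuous (fun u => g (Complex u y))}.
Proof.
move=> /continuousCP H; apply/continuousRCP => e /H[d d0 Hd].
apply/nbhs_ballP; exists d => //= u; rewrite /ball /= => ux; apply: Hd.
by rewrite complexB subrr nrm_ofR distrC.
Qed.

Lemma continuous_vline (g : C -> C) (x y : R) : {for Complex x y, continuous g} ->
  {for y, continuous (fun u => g (Complex x u))}.
Proof.
move=> /continuousCP H; apply/continuousRCP => e /H[d d0 Hd].
apply/nbhs_ballP; exists d => //= u; rewrite /ball /= => ux; apply: Hd.
by rewrite complexB subrr nrm_Complex0 distrC.
Qed.

Definition holo_rect (g : C -> C) (x1 x2 y1 y2 : R) :=
  forall x y, x1 <= x <= x2 -> y1 <= y <= y2 -> derivable g (Complex x y) 1.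

Lemma holo_rectS g x1 x2 y1 y2 a1 a2 b1 b2 : holo_rect g x1 x2 y1 y2 ->
  x1 <= a1 -> a2 <= x2 -> y1 <= b1 -> b2 <= y2 -> holo_rect g a1 a2 b1 b2.
Proof. by move=> H ? ? ? ? x y /andP[? ?] /andP[? ?]; apply: H; lra. Qed.

Lemma cont_hseg g x1 x2 y1 y2 y : holo_rect g x1 x2 y1 y2 -> y1 <= y <= y2 ->
  cont_seg x1 x2 (fun x => g (Complex x y)).
Proof.
by move=> H yy x xx; apply/continuous_hline/derivable_continuousC/H.
Qed.

Lemma cont_vseg g x1 x2 y1 y2 x : holo_rect g x1 x2 y1 y2 -> x1 <= x <= x2 ->
  cont_seg y1 y2 (fun y => g (Complex x y)).
Proof.
by move=> H yy y xx; apply/continuous_vline/derivable_continuousC/H.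
Qed.

(** The counterclockwise integral of [g] along the boundary, with opposite sides grouped: [dz] is
    [dx] on the horizontal sides and [i dy] on the vertical ones. *)
Definition rint (g : C -> C) (x1 x2 y1 y2 : R) : C :=
  cint x1 x2 (fun x => g (Complex x y1) - g (Complex x y2)) +
  iC * cint y1 y2 (fun y => g (Complex x2 y) - g (Complex x1 y)).

Lemma rint_splitx g x1 m x2 y1 y2 : holo_rect g x1 x2 y1 y2 ->
  x1 <= m <= x2 -> y1 <= y2 ->
  rint g x1 x2 y1 y2 = rint g x1 m y1 y2 + rint g m x2 y1 y2.
Proof.
move=> H xm yy; have /andP[x1m mx2] := xm.
have cy y : y1 <= y <= y2 -> cont_seg x1 x2 (fun x => g (Complex x y)).
  exact: cont_hseg.
have cx x : x1 <= x <= x2 -> cont_seg y1 y2 (fun y => g (Complex x y)).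
  exact: cont_vseg.
rewrite /rint (cint_split xm); last by apply: cont_segB; apply: cy; lra.
have -> : cint y1 y2 (fun y => g (Complex x2 y) - g (Complex x1 y)) =
    cint y1 y2 (fun y => g (Complex m y) - g (Complex x1 y)) +
    cint y1 y2 (fun y => g (Complex x2 y) - g (Complex m y)).
  rewrite -cintD; [|by apply: cont_segB; apply: cx; lra..].
  by apply: eq_cint => t _; ring.
ring.
Qed.

Lemma rint_splity g x1 x2 y1 m y2 : holo_rect g x1 x2 y1 y2 ->
  y1 <= m <= y2 -> x1 <= x2 ->
  rint g x1 x2 y1 y2 = rint g x1 x2 y1 m + rint g x1 x2 m y2.
Proof.
move=> H xm yy; have /andP[x1m mx2] := xm.
have cy y : y1 <= y <= y2 -> cont_seg x1 x2 (fun x => g (Complex x y)).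
  exact: cont_hseg.
have cx x : x1 <= x <= x2 -> cont_seg y1 y2 (fun y => g (Complex x y)).
  exact: cont_vseg.
rewrite /rint (cint_split xm); last by apply: cont_segB; apply: cx; lra.
have -> : cint x1 x2 (fun x => g (Complex x y1) - g (Complex x y2)) =
    cint x1 x2 (fun x => g (Complex x y1) - g (Complex x m)) +
    cint x1 x2 (fun x => g (Complex x m) - g (Complex x y2)).
  rewrite -cintD; [|by apply: cont_segB; apply: cy; lra..].
  by apply: eq_cint => t _; ring.
ring.
Qed.

Lemma cint_near_cst a b (f : R -> C) k M : a <= b -> cont_seg a b f ->
  (forall t, a <= t <= b -> nrm (f t - k) <= M) ->
  nrm (cint a b f - ofR (b - a) * k) <= 2 * M * (b - a).
Proof.
move=> ab Hf HM; have Hk := cont_seg_cst (a := a) (b := b) (c := k).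
rewrite -(cint_cst k ab) -(cintB Hf Hk).
exact: (cint_bound ab (cont_segB Hf Hk) HM).
Qed.

(** Near the point [g] is affine up to a small error. For the affine part, opposite sides differ by
    the constants [l * Complex 0 (y1 - y2)] and [l * ofR (x2 - x1)], whose contributions cancel.
    What remains is an error proportional to [s], integrated over sides of total length proportional
    to [s]. *)
Lemma rint_local g cx cy : derivable g (Complex cx cy) 1 ->
  forall e : R, 0 < e -> exists2 d : R, 0 < d &
    forall x1 x2 y1 y2, x1 <= cx <= x2 -> y1 <= cy <= y2 ->
      x2 - x1 + (y2 - y1) < d -> holo_rect g x1 x2 y1 y2 ->
      nrm (rint g x1 x2 y1 y2) <= e * (x2 - x1 + (y2 - y1)) ^+ 2.
Proof.
(* The factor 4 pays for the two errors in a difference of opposite sides and for the factor 2 of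
   [cint_bound]. *)
move=> /derivable_lip[l Hl] e e0; have e4 : 0 < e / 4 by lra.
have [d d0 Hd] := Hl _ e4; exists d => // x1 x2 y1 y2 /andP[a1 a2] /andP[b1 b2].
set s := x2 - x1 + (y2 - y1) => sd H.
have E x y : x1 <= x <= x2 -> y1 <= y <= y2 ->
    nrm (g (Complex x y) - g (Complex cx cy)
         - l * (Complex x y - Complex cx cy)) <= e / 4 * s.
  move=> /andP[? ?] /andP[? ?].
  have ns : nrm (Complex x y - Complex cx cy : C) <= s.
    apply: le_trans (nrm_complex _ _) _; rewrite /s; apply: lerD.
      by rewrite ler_norml; apply/andP; split; lra.
    by rewrite ler_norml; apply/andP; split; lra.
  apply: le_trans (Hd _ (le_lt_trans ns sd)) _.
  by rewrite ler_wpM2l//; lra.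
have s0 : 0 <= s by rewrite /s; lra.
have xx : x1 <= x2 by lra.
have yy : y1 <= y2 by lra.
have B1 : nrm (cint x1 x2 (fun x => g (Complex x y1) - g (Complex x y2))
    - ofR (x2 - x1) * (l * Complex 0 (y1 - y2))) <= 2 * (e / 2 * s) * (x2 - x1).
  apply: cint_near_cst => //.
    by apply: cont_segB; apply: (cont_hseg H); lra.
  move=> x xI; set c := g (Complex cx cy).
  have -> : g (Complex x y1) - g (Complex x y2) - l * Complex 0 (y1 - y2) =
    (g (Complex x y1) - c - l * (Complex x y1 - Complex cx cy)) -
    (g (Complex x y2) - c - l * (Complex x y2 - Complex cx cy)).
    have -> : Complex 0 (y1 - y2) = Complex x y1 - Complex x y2 :> C.
      by rewrite complexB subrr.
    ring.
  apply: le_trans (nrmD _ _) _; rewrite nrmN.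
  have := E x y1 xI; have := E x y2 xI; rewrite -/c => /(_ _)h1 /(_ _)h2.
  have -> : e / 2 * s = e / 4 * s + e / 4 * s by lra.
  by apply: lerD; [apply: h2|apply: h1]; lra.
have B2 : nrm (cint y1 y2 (fun y => g (Complex x2 y) - g (Complex x1 y))
    - ofR (y2 - y1) * (l * ofR (x2 - x1))) <= 2 * (e / 2 * s) * (y2 - y1).
  apply: cint_near_cst => //.
    by apply: cont_segB; apply: (cont_vseg H); lra.
  move=> y yI; set c := g (Complex cx cy).
  have -> : g (Complex x2 y) - g (Complex x1 y) - l * ofR (x2 - x1) =
    (g (Complex x2 y) - c - l * (Complex x2 y - Complex cx cy)) -
    (g (Complex x1 y) - c - l * (Complex x1 y - Complex cx cy)).
    have -> : ofR (x2 - x1) = Complex x2 y - Complex x1 y :> C.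
      by rewrite complexB subrr.
    ring.
  apply: le_trans (nrmD _ _) _; rewrite nrmN.
  have -> : e / 2 * s = e / 4 * s + e / 4 * s by lra.
  by apply: lerD; apply: E => //; lra.
have -> : rint g x1 x2 y1 y2 =
   (cint x1 x2 (fun x => g (Complex x y1) - g (Complex x y2))
    - ofR (x2 - x1) * (l * Complex 0 (y1 - y2))) +
   iC * (cint y1 y2 (fun y => g (Complex x2 y) - g (Complex x1 y))
    - ofR (y2 - y1) * (l * ofR (x2 - x1))).
  rewrite /rint.
  have -> : Complex 0 (y1 - y2) = - (iC * ofR (y2 - y1)) :> C.
    by apply: complex_ext; rewrite ?cReN ?cImN ?cReM ?cImM /=; ring.
  ring.
apply: le_trans (nrmD _ _) _; rewrite nrmM nrm_Complex0 normr1 mul1r.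
apply: le_trans (lerD B1 B2) _.
rewrite expr2 /s.
have -> : 2 * (e / 2 * (x2 - x1 + (y2 - y1))) * (x2 - x1) +
  2 * (e / 2 * (x2 - x1 + (y2 - y1))) * (y2 - y1) =
  e * ((x2 - x1 + (y2 - y1)) * (x2 - x1 + (y2 - y1))) by field.
exact: lexx.
Qed.

(** The common point is the supremum of the left ends. *)
Lemma nested_intervals (X w : nat -> R) : (forall n, X n <= X n.+1) ->
  (forall n, X n.+1 + w n.+1 <= X n + w n) -> (forall n, 0 <= w n) ->
  exists c, forall n, X n <= c <= X n + w n.
Proof.
move=> X1 w1 w0.
have Xm m n : (m <= n)%N -> X m <= X n.
  exact: (nondecreasing_seqP X).1.
have wm m n : (m <= n)%N -> X n + w n <= X m + w m.
  exact: (nonincreasing_seqP (fun n => X n + w n)).1.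
have Xw m n : X m <= X n + w n.
  have [mn|/ltnW nm] := leqP m n.
    by apply: le_trans (Xm _ _ mn) _; rewrite lerDl.
  by apply: le_trans (wm _ _ nm); rewrite lerDl.
exists (sup (range X)) => n; apply/andP; split.
  by apply: ub_le_sup; [exists (X 0%N + w 0%N) => _ [m _ <-]|exists n].
by apply: ge_sup; [exists (X 0%N), 0%N|move=> _ [m _ <-]].
Qed.

Lemma ex_small_pow (W d : R) : 0 < d -> exists n, W / 2 ^+ n < d.
Proof.
move=> d0; exists (Num.Def.archi_bound (W / d)).
rewrite ltr_pdivrMr ?exprn_gt0// mulrC -ltr_pdivrMr//.
exact: (upper_nthrootP (leqnn _)).
Qed.

(** Bisection: one of four quarters carries at least a quarter of the integral. Along the nested
    rectangles the integral stays at least [eta / 4 ^+ n], whereas [rint_local] at their common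
    point bounds it by [e * (W + K) ^+ 2 / 4 ^+ n]. *)
Theorem goursat g x1 x2 y1 y2 : x1 <= x2 -> y1 <= y2 ->
  holo_rect g x1 x2 y1 y2 -> rint g x1 x2 y1 y2 = 0.
Proof.
move=> xx yy H; apply: contrapT => /eqP; rewrite -nrm_gt0 => eta0.
set eta := nrm _ in eta0; pose W := x2 - x1; pose K := y2 - y1.
have W0 : 0 <= W by rewrite /W; lra.
have K0 : 0 <= K by rewrite /K; lra.
pose I n (p : R * R) := rint g p.1 (p.1 + W / 2 ^+ n) p.2 (p.2 + K / 2 ^+ n).
pose Good n (p : R * R) :=
  [/\ x1 <= p.1, p.1 + W / 2 ^+ n <= x2, y1 <= p.2, p.2 + K / 2 ^+ n <= y2 &
   eta / 4 ^+ n <= nrm (I n p)].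
have half (V : R) n : V / 2 ^+ n = V / 2 ^+ n.+1 + V / 2 ^+ n.+1.
  by rewrite exprS; field; rewrite expf_neq0//; lra.
(* Stated for every pair and conditioned on [Good], so that choice yields a total successor
   function. *)
have step (np : nat * (R * R)) : exists p' : R * R, Good np.1 np.2 ->
    [/\ Good np.1.+1 p', np.2.1 <= p'.1,
      p'.1 + W / 2 ^+ np.1.+1 <= np.2.1 + W / 2 ^+ np.1,
      np.2.2 <= p'.2 &
      p'.2 + K / 2 ^+ np.1.+1 <= np.2.2 + K / 2 ^+ np.1].
  case: np => n [x y] /=.
  have [G|nG] := pselect (Good n (x, y)); last by exists (x, y).
  case: G; rewrite /= (half W) (half K).
  set w := W / 2 ^+ n.+1; set k := K / 2 ^+ n.+1 => Gx1 Gx2 Gy1 Gy2 GI.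
  have w0 : 0 <= w by rewrite divr_ge0 ?exprn_ge0.
  have k0 : 0 <= k by rewrite divr_ge0 ?exprn_ge0.
  have HG : holo_rect g x (x + (w + w)) y (y + (k + k)).
    by apply: holo_rectS H _ _ _ _.
  have E : I n (x, y) = I n.+1 (x, y) + I n.+1 (x, y + k) +
      (I n.+1 (x + w, y) + I n.+1 (x + w, y + k)).
    rewrite /I /= (half W) (half K) -/w -/k.
    rewrite (@rint_splitx _ _ (x + w))//; [|lra..].
    rewrite (@rint_splity _ _ _ _ (y + k)); [| |lra..]; last first.
      by apply: holo_rectS HG _ _ _ _; lra.
    congr (_ + _); rewrite -!addrA //.
    rewrite (@rint_splity _ _ _ _ (y + k)) -?addrA //; [|lra..].
    by apply: holo_rectS HG _ _ _ _; lra.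
  suff [p [Gp [p1 p2]]] : exists p, eta / 4 ^+ n.+1 <= nrm (I n.+1 p) /\
      (p.1 = x \/ p.1 = x + w) /\ (p.2 = y \/ p.2 = y + k).
    have B1 : x <= p.1 <= x + w by case: p1 => ->; lra.
    have B2 : y <= p.2 <= y + k by case: p2 => ->; lra.
    by exists p => _; split; rewrite ?/Good -/w -/k; try (split => //); lra.
  (* If all four quarters were small, the triangle inequality would make the whole smaller than
     [eta / 4 ^+ n]. *)
  apply: contrapT => nE.
  have B p : (p.1 = x \/ p.1 = x + w) -> (p.2 = y \/ p.2 = y + k) ->
      nrm (I n.+1 p) < eta / 4 ^+ n.+1.
    by move=> ? ?; rewrite ltNge; apply/negP => ?; apply: nE; exists p.
  have := B (x, y) (or_introl erefl) (or_introl erefl).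
  have := B (x, y + k) (or_introl erefl) (or_intror erefl).
  have := B (x + w, y) (or_intror erefl) (or_introl erefl).
  have := B (x + w, y + k) (or_intror erefl) (or_intror erefl).
  have := nrmD (I n.+1 (x, y) + I n.+1 (x, y + k))
    (I n.+1 (x + w, y) + I n.+1 (x + w, y + k)); rewrite -E.
  have := nrmD (I n.+1 (x, y)) (I n.+1 (x, y + k)).
  have := nrmD (I n.+1 (x + w, y)) (I n.+1 (x + w, y + k)).
  have : eta / 4 ^+ n = 4 * (eta / 4 ^+ n.+1).
    by rewrite exprS; field; rewrite expf_neq0//; lra.
  by move: GI; clear; lra.
have [stp Hstp] := choice step.
pose s := fix s n := if n is m.+1 then stp (m, s m) else (x1, y1).
have Gs n : Good n (s n).
  elim: n => [|n IH]; last by have [] := Hstp (n, s n) IH.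
  have EW : x1 + W = x2 by rewrite /W addrC subrK.
  have EK : y1 + K = y2 by rewrite /K addrC subrK.
  by rewrite /Good /I /= !expr0 !divr1 EW EK; split.
have [cx Hcx] : exists c, forall n, (s n).1 <= c <= (s n).1 + W / 2 ^+ n.
  apply: nested_intervals => n; last by rewrite divr_ge0 ?exprn_ge0.
    by have [] := Hstp (n, s n) (Gs n).
  by have [] := Hstp (n, s n) (Gs n).
have [cy Hcy] : exists c, forall n, (s n).2 <= c <= (s n).2 + K / 2 ^+ n.
  apply: nested_intervals => n; last by rewrite divr_ge0 ?exprn_ge0.
    by have [] := Hstp (n, s n) (Gs n).
  by have [] := Hstp (n, s n) (Gs n).
have Dc : derivable g (Complex cx cy) 1.
  have [/= ? ? ? ? _] := Gs 0%N; have := Hcx 0%N; have := Hcy 0%N => /= *.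
  by apply: H; lra.
(* Chosen so that [e * (W + K) ^+ 2 < eta]; the [+ 1] keeps the denominator positive for a
   degenerate rectangle. *)
pose e := eta / (2 * ((W + K) ^+ 2 + 1)).
have WK : 0 <= (W + K) ^+ 2 by rewrite sqr_ge0.
have e0 : 0 < e by rewrite divr_gt0//; lra.
have [d d0 Hd] := rint_local Dc e0.
have [n nd] := ex_small_pow (W + K) d0.
have [/= G1 G2 G3 G4 G5] := Gs n.
have := Hd _ _ _ _ (Hcx n) (Hcy n).
have -> : (s n).1 + W / 2 ^+ n - (s n).1 + ((s n).2 + K / 2 ^+ n - (s n).2) =
  (W + K) / 2 ^+ n by ring.
move=> /(_ nd (holo_rectS H G1 G2 G3 G4)).
rewrite -/(I n (s n)) expr_div_n -exprM mulnC exprM.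
have -> : 2 ^+ 2 = 4 :> R by ring.
move=> /(le_trans G5); rewrite mulrA ler_pM2r ?invr_gt0 ?exprn_gt0//.
rewrite /e -mulrA => h.
have : (2 * ((W + K) ^+ 2 + 1))^-1 * (W + K) ^+ 2 < 1.
  by rewrite mulrC ltr_pdivrMr ?mul1r; lra.
by move: h; rewrite ler_pMr// => h1 h2; lra.
Qed.

(** Periodicity makes the two horizontal sides cancel in Goursat's theorem, so the vertical ones
    agree. *)
Lemma vertical_integral g x1 x2 : x1 <= x2 -> holo_rect g x1 x2 0 (pi *+ 2) ->
  (forall x, x1 <= x <= x2 -> g (Complex x (pi *+ 2)) = g (Complex x 0)) ->
  cint 0 (pi *+ 2) (fun t => g (Complex x1 t)) =
  cint 0 (pi *+ 2) (fun t => g (Complex x2 t)).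
Proof.
move=> xx H per; have p0 : 0 <= pi *+ 2 :> R by rewrite mulrn_wge0 ?pi_ge0.
have := goursat xx p0 H; rewrite /rint.
rewrite (@eq_cint _ x1 x2 _ (fun=> 0)); last by move=> x /per ->; rewrite subrr.
rewrite cint_cst// mulr0 add0r => /eqP; rewrite mulf_eq0 => /orP[/eqP[/eqP]|].
  by rewrite oner_eq0.
rewrite cintB; [|by apply: (cont_vseg H); rewrite ?lexx ?xx..].
by rewrite subr_eq0 => /eqP.
Qed.

End Goursat.

(** * Means over circles *)

Section ComplexCalculus.
Variable R : realType.
Local Notation C := (Cplx R).
Implicit Types f g : C -> C.

Lemma contCM f g z : {for z, continuous f} -> {for z, continuous g} ->
  {for z, continuous (fun w => f w * g w)}.
Proof. by move=> cf cg; exact: (@cvgM _ _ _ _ f g _ _ cf cg). Qed.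

Lemma contCD f g z : {for z, continuous f} -> {for z, continuous g} ->
  {for z, continuous (fun w => f w + g w)}.
Proof. by move=> cf cg; exact: (@cvgD _ _ _ _ _ f g _ _ cf cg). Qed.

Lemma contCN f z : {for z, continuous f} -> {for z, continuous (fun w => - f w)}.
Proof. by move=> cf; exact: (@cvgN _ _ _ _ _ f _ cf). Qed.

Lemma contCV f z : f z != 0 -> {for z, continuous f} ->
  {for z, continuous (fun w => (f w)^-1)}.
Proof. by move=> f0 cf; exact: (@cvgV _ _ _ _ f _ f0 cf). Qed.

Lemma contC_cst (c : C) z : {for z, continuous (fun _ : C => c)}.
Proof. exact: cst_continuous. Qed.

Lemma contC_id z : {for z, continuous (fun w : C => w)}.
Proof. exact: cvg_id. Qed.

Lemma contC_comp f g z : {for z, continuous f} -> {for f z, continuous g} ->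
  {for z, continuous (fun w => g (f w))}.
Proof. by move=> cf cg; exact: (@continuous_comp _ _ _ f g z cf cg). Qed.

Lemma derivCM f g z : derivable f z 1 -> derivable g z 1 ->
  derivable (fun w => f w * g w) z 1.
Proof. by move=> df dg; exact: (@derivableM _ _ f g z 1 df dg). Qed.

Lemma derivCD f g z : derivable f z 1 -> derivable g z 1 ->
  derivable (fun w => f w + g w) z 1.
Proof. by move=> df dg; exact: (@derivableD _ _ _ f g z 1 df dg). Qed.

Lemma derivCN f z : derivable f z 1 -> derivable (fun w => - f w) z 1.
Proof. by move=> df; exact: (@derivableN _ _ _ f z 1 df). Qed.

Lemma derivCV f z : f z != 0 -> derivable f z 1 ->
  derivable (fun w => (f w)^-1) z 1.
Proof. by move=> f0 df; exact: (@derivableV _ _ f z 1 f0 df). Qed.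

Lemma derivC_cst (c : C) z : derivable (fun _ : C => c) z 1.
Proof. exact: derivable_cst. Qed.

Lemma derivC_id z : derivable (fun w : C => w) z 1.
Proof. exact: derivable_id. Qed.

Lemma derivCX f n z : derivable f z 1 -> derivable (fun w => f w ^+ n) z 1.
Proof.
move=> df; elim: n => [|n IH]; first exact: derivC_cst.
have -> : (fun w => f w ^+ n.+1) = (fun w => f w * f w ^+ n).
  by apply/funext => w; rewrite exprS.
exact: (derivCM df IH).
Qed.

(** Caratheodory factors multiply under composition. *)
Lemma derivC_comp f g z : derivable f z 1 -> derivable g (f z) 1 ->
  derivable (fun w => g (f w)) z 1.
Proof.
move=> /[dup] /derivable_continuousC cf /derivableCP[phi [cphi Hf]].
move=> /derivableCP[gam [cgam Hg]]; apply/derivableCP.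
exists (fun w => gam (f w) * phi w); split.
  exact: (contCM (contC_comp cf cgam) cphi).
by move=> w; rewrite Hg Hf mulrA.
Qed.

End ComplexCalculus.
Arguments derivC_id {R} z.
Arguments derivC_cst {R} c z.
Arguments contC_id {R} z.
Arguments contC_cst {R} c z.

(** * The complex exponential and its derivative *)

Section ComplexExponential.
Variable R : realType.
Local Notation C := (Cplx R).
Local Notation Re := (@complex.Re R).
Local Notation Im := (@complex.Im R).

Lemma expCD (z w : C) : expC (z + w) = expC z * expC w.
Proof.
by apply: complex_ext; rewrite ?cReM ?cImM /= cReD cImD expRD ?cosD ?sinD; ring.
Qed.

Lemma nrm_expC (z : C) : nrm (expC z) = expR (Re z).
Proof.
rewrite /nrm /= !exprMn -mulrDr cos2Dsin2 mulr1 sqrtr_sqr.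
by rewrite ger0_norm ?expR_ge0.
Qed.

Lemma expC_neq0 (z : C) : expC z != 0.
Proof. by rewrite -nrm_gt0 nrm_expC expR_gt0. Qed.

Lemma expC0 : expC (0 : C) = 1.
Proof. by rewrite /expC /= expR0 cos0 sin0 !mul1r. Qed.

Lemma expC_2pi (x : R) : expC (Complex x (pi *+ 2)) = expC (Complex x 0).
Proof. by rewrite /expC /= cos2pi sin2pi cos0 sin0. Qed.

Lemma is_derive_lip (f : R -> R) (x l : R) : is_derive x 1 f l ->
  forall e : R, 0 < e -> exists2 d : R, 0 < d &
    forall h, `|h| < d -> `|f (x + h) - f x - l * h| <= e * `|h|.
Proof.
move=> [df dl] e e0.
have : (fun h => h^-1 *: ((f \o shift x) (h *: 1) - f x)) @ 0^' --> l.
  by rewrite -dl; exact: df.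
move=> /cvgrPdist_lt/(_ e e0)/nbhs_ballP[d /= d0 Hd].
exists d => // h hd; have [->|h0] := eqVneq h 0.
  by rewrite addr0 mulr0 subrr subr0 normr0 mulr0.
have : ball 0 d h by rewrite /ball /= sub0r normrN.
move=> /Hd/(_ h0) /=; rewrite scaler1 /shift [h + x]addrC [_ *: _]mulrC => hh.
have -> : f (x + h) - f x - l * h = - ((l - (f (x + h) - f x) / h) * h).
  by rewrite mulrBl divfK//; ring.
by rewrite normrN normrM ler_wpM2r// ltW.
Qed.

(** Complex differentiability at 0, from the real first-order expansions of [expR], [cos] and [sin];
    the addition formula then carries it to every point. *)
Lemma expC_sub1 (e : R) : 0 < e -> exists2 d : R, 0 < d & forall h : C,
  nrm h < d -> nrm (expC h - 1 - h) <= e * nrm h.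
Proof.
(* The real part will have error [4 * e' * n] and the imaginary part [5 * e' * n], hence the 9;
   [e' <= 1] serves to bound [expR x - 1] and [sin y] by [2 * n]. *)
move=> e0; have [e' [e'0 e'1 e'9]] : exists e' : R, [/\ 0 < e', e' <= 1 & 9 * e' <= e].
  exists (Num.min 1 (e / 9)); rewrite ge_min lexx lt_min; split=> //; first lra.
  have : Num.min 1 (e / 9) <= e / 9 by rewrite ge_min lexx orbT.
  by move=> ?; lra.
have [d1 d10 H1] := is_derive_lip (is_derive_expR (0 : R)) e'0.
have [d2 d20 H2] := is_derive_lip (is_derive_cos (0 : R)) e'0.
have [d3 d30 H3] := is_derive_lip (is_derive_sin (0 : R)) e'0.
exists (Num.min (Num.min d1 d2) (Num.min d3 e')).
  by rewrite !lt_min d10 d20 d30.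
move=> [x y]; rewrite !lt_min => /andP[/andP[hd1 hd2] /andP[hd3 hde]].
set n := nrm _ in hd1 hd2 hd3 hde *.
have xn : `|x| <= n := le_Re_nrm (Complex x y : C).
have yn : `|y| <= n := le_Im_nrm (Complex x y : C).
have n0 : 0 <= n := nrm_ge0 _.
have := H1 x (le_lt_trans xn hd1); have := H2 y (le_lt_trans yn hd2).
have := H3 y (le_lt_trans yn hd3).
rewrite !add0r expR0 cos0 sin0 !(oppr0, mul0r, mul1r, subr0, addr0) => hs hc hx.
have ex : `|expR x - 1| <= 2 * n.
  have -> : expR x - 1 = (expR x - 1 - x) + x by ring.
  apply: le_trans (ler_normD _ _) _.
  have : e' * `|x| <= 1 * n by apply: ler_pM => //; exact: ltW.
  by move=> ?; lra.
have sy : `|sin y| <= 2 * n.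
  have -> : sin y = (sin y - y) + y by ring.
  apply: le_trans (ler_normD _ _) _.
  have : e' * `|y| <= 1 * n by apply: ler_pM => //; exact: ltW.
  by move=> ?; lra.
have ex3 : `|expR x| <= 3.
  have -> : expR x = (expR x - 1) + 1 by ring.
  apply: le_trans (ler_normD _ _) _; rewrite normr1; lra.
have B1 : `|expR x * cos y - 1 - x| <= 4 * e' * n.
  have -> : expR x * cos y - 1 - x = (expR x - 1 - x) + expR x * (cos y - 1).
    ring.
  apply: le_trans (ler_normD _ _) _; rewrite normrM.
  have h1 : e' * `|x| <= e' * n by rewrite ler_wpM2l// ltW.
  have h2 : e' * `|y| <= e' * n by rewrite ler_wpM2l// ltW.
  have h3 : `|expR x| * `|cos y - 1| <= 3 * (e' * n).
    by apply: ler_pM => //; exact: le_trans hc h2.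
  lra.
have B2 : `|expR x * sin y - y| <= 5 * e' * n.
  have -> : expR x * sin y - y = (expR x - 1) * sin y + (sin y - y) by ring.
  apply: le_trans (ler_normD _ _) _; rewrite normrM.
  have h2 : e' * `|y| <= e' * n by rewrite ler_wpM2l// ltW.
  have h3 : `|expR x - 1| * `|sin y| <= (2 * n) * (2 * n) by apply: ler_pM.
  have h4 : n * n <= e' * n by rewrite ler_wpM2r// ltW.
  lra.
have -> : expC (Complex x y) - 1 - Complex x y =
    Complex (expR x * cos y - 1 - x) (expR x * sin y - y) :> C.
  by apply: complex_ext; rewrite !(cReD, cReN, cImD, cImN) /=; ring.
apply: le_trans (nrm_complex _ _) _.
have : 9 * e' * n <= e * n by rewrite ler_wpM2r.
lra.
Qed.

Lemma derivable_expC (z : C) : derivable (@expC R) z 1.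
Proof.
apply/derivable_lip; exists (expC z) => e e0.
have k0 : 0 < e / nrm (expC z) by rewrite divr_gt0// nrm_gt0 expC_neq0.
have [d d0 Hd] := expC_sub1 k0; exists d => // w wd.
have -> : expC w - expC z - expC z * (w - z) =
    expC z * (expC (w - z) - 1 - (w - z)).
  have {1}-> : expC w = expC z * expC (w - z) by rewrite -expCD addrC subrK.
  ring.
rewrite nrmM; apply: le_trans (ler_wpM2l (nrm_ge0 _) (Hd _ wd)) _.
by rewrite mulrA mulrCA divff ?mulr1// nrm_eq0 expC_neq0.
Qed.

Lemma continuous_expC (z : C) : {for z, continuous (@expC R)}.
Proof. exact/derivable_continuousC/derivable_expC. Qed.

Lemma near_eq_continuousC (f g : C -> C) z : (\forall w \near z, f w = g w) ->
  {for z, continuous f} -> {for z, continuous g}.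
Proof.
move=> /[dup] fg /nbhs_singleton fgz /continuousCP Hl.
apply/continuousCP => e /Hl[d d0 Hd]; have /nbhsCP[d' d'0 Hd'] := fg.
exists (Num.min d d'); first by rewrite lt_min d0.
by move=> w; rewrite lt_min => /andP[wd wd']; rewrite -fgz -Hd'//; apply: Hd.
Qed.

End ComplexExponential.

(** * Independence of the radius *)

Section CircleMean.
Variable R : realType.
Local Notation C := (Cplx R).
Local Notation Re := (@complex.Re R).
Local Notation Im := (@complex.Im R).
Local Notation tpi := (pi *+ 2 : R).
Implicit Types f g psi : C -> C.

Lemma tpi_gt0 : 0 < tpi.
Proof. by rewrite pmulrn_lgt0// pi_gt0. Qed.

(** The radius enters through its logarithm [x], so that a circle is the image of a vertical segment
    under [expC]. *)
Definition circ (x t : R) : C := expC (Complex x t).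

Lemma nrm_circ x t : nrm (circ x t) = expR x.
Proof. exact: nrm_expC. Qed.

(* 2 pi times the mean of psi on the circle of centre 0 and radius e ^ x. *)
Definition mean psi (x : R) : C := cint 0 tpi (fun t => psi (circ x t)).

Lemma cont_circ psi x : (forall z, nrm z = expR x -> {for z, continuous psi}) ->
  cont_seg 0 tpi (fun t => psi (circ x t)).
Proof.
move=> H t _.
apply: (@continuous_vline R (fun z => psi (expC z)) x t).
apply: contC_comp; first exact: continuous_expC.
by apply: H; exact: nrm_circ.
Qed.

Lemma mean_const psi x1 x2 : x1 <= x2 ->
  (forall z, expR x1 <= nrm z <= expR x2 -> derivable psi z 1) ->
  mean psi x1 = mean psi x2.
Proof.
move=> xx H.
apply: (@vertical_integral R (fun z => psi (expC z)) x1 x2) => //; last first.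
  by move=> x _ /=; rewrite expC_2pi.
move=> x y xI _; apply: derivC_comp; first exact: derivable_expC.
by apply: H; rewrite nrm_expC /= !ler_expR.
Qed.

(** Uniformity in [t] comes from the compactness of [[0, 2 pi]]. *)
Lemma mean_continuous psi x0 :
  (forall z, nrm z = expR x0 -> {for z, continuous psi}) ->
  forall e : R, 0 < e -> \forall x \near x0,
    forall t, 0 <= t <= tpi -> nrm (psi (circ x t) - psi (circ x0 t)) < e.
Proof.
move=> H e e0.
have cK : near_covering (`[0, tpi]%classic : set R).
  by apply/compact_near_coveringP; exact: segment_compact.
have := cK R (nbhs x0) (fun x t => nrm (psi (circ x t) - psi (circ x0 t)) < e)
  (nbhs_filter _).
move=> h; suff : \forall x \near x0, `[0, tpi]%classic `<=`
    (fun t => nrm (psi (circ x t) - psi (circ x0 t)) < e).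
  by apply: filterS => x Hx t tI; apply: Hx; rewrite /= in_itv.
apply: h => t _.
have e2 : 0 < e / 2 by lra.
have /continuousCP/(_ _ e2)[d d0 Hd] :
    {for Complex x0 t, continuous (fun z => psi (expC z))}.
  apply: contC_comp; first exact: continuous_expC.
  by apply: H; exact: nrm_circ.
exists (ball t (d / 2), ball x0 (d / 2)).
  by split; apply: nbhsx_ballx; lra.
move=> [u x] [] /=; rewrite /ball /= => tu xu.
have n1 : nrm (Complex x u - Complex x0 t : C) < d.
  rewrite complexB; apply: le_lt_trans (nrm_complex _ _) _.
  rewrite distrC [ `|u - t|]distrC; lra.
have n2 : nrm (Complex x0 u - Complex x0 t : C) < d.
  rewrite complexB; apply: le_lt_trans (nrm_complex _ _) _.
  rewrite subrr normr0 add0r distrC; lra.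
have := Hd _ n1; have := Hd _ n2; rewrite -!/(circ _ _).
have := nrmBD (psi (circ x0 t)) (psi (circ x u)) (psi (circ x0 u)).
rewrite [nrm (psi (circ x0 t) - _)]nrmB; lra.
Qed.

Lemma nrm_small0 (z : C) (K : R) : (forall e : R, 0 < e -> nrm z <= K * e) -> z = 0.
Proof.
move=> H; apply/eqP; rewrite -nrm_eq0; apply/eqP/le_anti; rewrite nrm_ge0 andbT.
apply/ler_addgt0Pr => e e0; rewrite add0r.
have k0 : 0 < `|K| + 1 by rewrite ltr_wpDl.
have /H h : 0 < e / (`|K| + 1) by rewrite divr_gt0.
apply: le_trans h _; rewrite mulrA ler_pdivrMr// mulrC ler_pM2l//.
by have := ler_norm K; lra.
Qed.

Lemma mean_diff psi x y M :
  (forall z, nrm z = expR x -> {for z, continuous psi}) ->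
  (forall z, nrm z = expR y -> {for z, continuous psi}) ->
  (forall t, 0 <= t <= tpi -> nrm (psi (circ x t) - psi (circ y t)) <= M) ->
  nrm (mean psi x - mean psi y) <= 2 * M * tpi.
Proof.
move=> /cont_circ cx /cont_circ cy HM; rewrite -(cintB cx cy).
have := cint_bound (ltW tpi_gt0) (cont_segB cx cy) HM.
by rewrite subr0.
Qed.

(** Differentiability may fail on the circle of radius [rho], which will be the one through the base
    point of a difference quotient. The mean is constant on either side of it, continuity carries it
    across, and continuity at 0 identifies it by letting the radius shrink. *)
Lemma mean_center psi (r0 rho r : R) : 0 < rho < r0 -> 0 < r < r0 ->
  (forall z, nrm z < r0 -> {for z, continuous psi}) ->
  (forall z, 0 < nrm z < r0 -> nrm z != rho -> derivable psi z 1) ->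
  mean psi (ln r) = ofR tpi * psi 0.
Proof.
move=> /andP[rho0 rhor0] /andP[r_gt0 rr0] cpsi dpsi.
have lnrho : expR (ln rho) = rho by rewrite lnK.
have ct x : expR x < r0 -> forall z, nrm z = expR x -> {for z, continuous psi}.
  by move=> xr z zx; apply: cpsi; rewrite zx.
have crho : forall z, nrm z = expR (ln rho) -> {for z, continuous psi}.
  by apply: ct; rewrite lnrho.
have all_eq x : expR x < r0 -> mean psi x = mean psi (ln rho).
  move=> xr; have [xlt|xgt|->//] := ltgtP x (ln rho).
    apply/eqP; rewrite -subr_eq0; apply/eqP/(@nrm_small0 _ (2 * tpi)) => e e0.
    have /nbhs_ballP[d /= d0 Hd] := mean_continuous crho e0.
    (* A logarithmic radius from [x] on, still below [ln rho] but so close to it that the two means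
       differ by at most a multiple of [e]. *)
    pose y := Num.max x (ln rho - d / 2).
    have yx : x <= y by rewrite le_max lexx.
    have yl : y < ln rho by rewrite gt_max xlt /=; lra.
    have yd : ball (ln rho) d y.
      rewrite /ball /= gtr0_norm; last by lra.
      have : ln rho - d / 2 <= y by rewrite le_max lexx orbT.
      lra.
    have yr : expR y < rho by rewrite -lnrho ltr_expR.
    have -> : mean psi x = mean psi y.
      apply: mean_const => // z /andP[z1 z2]; apply: dpsi.
        by rewrite (lt_le_trans (expR_gt0 x))//=; apply: le_lt_trans z2 _; lra.
      by rewrite lt_eqF// (le_lt_trans z2).
    have := mean_diff (ct _ (lt_trans yr rhor0)) crho
      (fun t tI => ltW (Hd y yd t tI)).
    by rewrite mulrAC.
  apply/eqP; rewrite -subr_eq0; apply/eqP/(@nrm_small0 _ (2 * tpi)) => e e0.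
  have /nbhs_ballP[d /= d0 Hd] := mean_continuous crho e0.
  pose y := Num.min x (ln rho + d / 2).
  have yx : y <= x by rewrite ge_min lexx.
  have yl : ln rho < y by rewrite lt_min xgt /=; lra.
  have yd : ball (ln rho) d y.
    rewrite /ball /= ltr0_norm; last by lra.
    have : y <= ln rho + d / 2 by rewrite ge_min lexx orbT.
    lra.
  have yr : rho < expR y by rewrite -lnrho ltr_expR.
  have <- : mean psi y = mean psi x.
    apply: mean_const => // z /andP[z1 z2]; apply: dpsi.
      by rewrite (lt_le_trans (expR_gt0 y))//=; apply: le_lt_trans z2 _.
    by rewrite gt_eqF// (lt_le_trans yr).
  have yr0 : expR y < r0 by apply: le_lt_trans xr; rewrite ler_expR.
  have := mean_diff (ct _ yr0) crho (fun t tI => ltW (Hd y yd t tI)).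
  by rewrite mulrAC.
rewrite all_eq ?lnK//; apply/eqP; rewrite -subr_eq0; apply/eqP.
apply: (@nrm_small0 _ (2 * tpi)) => e e0.
have r00 : 0 < r0 by lra.
have n00 : nrm (0 : C) < r0 by rewrite nrm0.
have /continuousCP H0 := cpsi 0 n00; have [d d0 Hd] := H0 _ e0.
(* A radius inside the disc and so small that [psi] is within [e] of [psi 0] on the circle. *)
pose x := ln (Num.min (r0 / 2) (d / 2)).
have xE : expR x = Num.min (r0 / 2) (d / 2).
  by rewrite lnK// posrE lt_min; apply/andP; split; lra.
have xr0 : expR x < r0.
  by rewrite xE gt_min; apply/orP; left; lra.
have xd : expR x < d.
  by rewrite xE gt_min; apply/orP; right; lra.
rewrite -(all_eq x xr0).
have := cint_near_cst (k := psi 0) (M := e) (ltW tpi_gt0) (cont_circ (ct _ xr0)).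
rewrite subr0 mulrAC; apply => t _; apply/ltW/Hd.
by rewrite subr0 nrm_circ.
Qed.

End CircleMean.

(** * The Cauchy formula *)

Section CauchyFormula.
Variable R : realType.
Local Notation C := (Cplx R).
Local Notation tpi := (pi *+ 2 : R).
Implicit Types f g psi : C -> C.

Lemma kernel_sub1 (z w : C) : z != w -> z / (z - w) - 1 = w / (z - w).
Proof. by move=> zw; field; rewrite subr_eq0. Qed.

Lemma nrm_sub_ge (z w : C) : nrm z - nrm w <= nrm (z - w).
Proof. by rewrite lerBlDr; have := nrmD (z - w) w; rewrite subrK. Qed.

Lemma neq_of_nrm (z w : C) : nrm w < nrm z -> z != w.
Proof. by apply: contraTneq => ->; rewrite ltxx. Qed.

Lemma derivC_kernel (w z : C) : z != w -> derivable (fun u : C => u / (u - w)) z 1.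
Proof.
move=> zw; have zw0 : z - w != 0 by rewrite subr_eq0.
exact: (derivCM (derivC_id z)
  (derivCV (f := fun z : C => z - w) zw0 (derivCD (derivC_id z) (derivC_cst (- w) z)))).
Qed.

(** The mean does not depend on the radius beyond [nrm w], and the kernel tends to 1 as the radius
    grows. *)
Lemma mean_kernel (w : C) (r : R) : 0 < r -> nrm w < r ->
  mean (fun z : C => z / (z - w)) (ln r) = ofR tpi.
Proof.
move=> r0 wr; apply/eqP; rewrite -subr_eq0; apply/eqP.
apply: (@nrm_small0 _ _ (2 * tpi)) => e e0.
have w0 := nrm_ge0 w.
have we0 : 0 <= nrm w / e by rewrite divr_ge0// ltW.
(* On the circle of radius [Y], [nrm (z - w)] is at least [nrm w / e], so the kernel is within [e]
   of 1. *)
pose Y := r + nrm w / e + nrm w; pose X := ln Y.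
have XE : expR X = Y by rewrite lnK// posrE /Y; lra.
have -> : mean (fun z : C => z / (z - w)) (ln r) = mean (fun z : C => z / (z - w)) X.
  apply: mean_const; first by rewrite ler_ln ?posrE /Y; lra.
  move=> z /andP[z1 _]; apply/derivC_kernel/neq_of_nrm.
  by move: z1; rewrite lnK// => /(lt_le_trans wr).
have czX z : nrm z = expR X -> z != w.
  by move=> zX; apply: neq_of_nrm; rewrite zX XE /Y; lra.
have cc : cont_seg 0 tpi (fun t => circ X t / (circ X t - w)).
  apply: (cont_circ (psi := fun z : C => z / (z - w))) => z /czX zw.
  exact/derivable_continuousC/derivC_kernel.
have := cint_near_cst (k := 1) (M := e) (ltW (tpi_gt0 R)) cc.
rewrite subr0 mulr1 mulrAC; apply => t _.
have cw := czX _ (nrm_circ X t).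
rewrite kernel_sub1// nrmM nrmV ler_pdivrMr; last by rewrite nrm_gt0 subr_eq0.
have := nrm_sub_ge (circ X t) w; rewrite nrm_circ XE /Y => h.
apply: (@le_trans _ _ (e * (nrm w / e))).
  by rewrite mulrC divfK// gt_eqF.
by rewrite ler_wpM2l ?(ltW e0)//; lra.
Qed.

(** [mean_center] is applied to [z * phi z], where [phi] is the difference quotient of [f] at [w]:
    this function vanishes at 0, is continuous at [w], and is differentiable off 0 and the circle
    through [w]. Differentiability of [f] at 0 is not assumed, which is what removes singularities
    later. *)
Theorem cauchy_formula f (r0 r : R) (w : C) : 0 < r < r0 -> nrm w < r ->
  (forall z, nrm z < r0 -> {for z, continuous f}) ->
  (forall z, 0 < nrm z < r0 -> derivable f z 1) ->
  mean (fun z : C => f z * (z / (z - w))) (ln r) = ofR tpi * f w.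
Proof.
move=> rr0 wr cf df; have /andP[r_gt0 r_lt] := rr0.
have lnr : expR (ln r) = r by rewrite lnK.
(* At 0 there may be no difference quotient; but for [w = 0] the kernel is 1 and [mean_center]
   applies to [f] itself, with [r0 / 2] as an arbitrary exceptional radius. *)
have [w0|w_neq0] := eqVneq w 0.
  rewrite w0; have <- : mean f (ln r) = ofR tpi * f 0.
    apply: (@mean_center R f r0 (r0 / 2) r); [by lra|exact: rr0|exact: cf|].
    by move=> z zr _; exact: df.
  apply: eq_cint => t _; rewrite subr0 divff ?mulr1//.
  by rewrite -nrm_gt0 nrm_circ lnr.
have nw0 : 0 < nrm w by rewrite nrm_gt0.
have wr0 : nrm w < r0 by lra.
have /derivableCP[phi [cphi Hphi]] : derivable f w 1 by apply: df; rewrite nw0.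
have phiE z : z != w -> \forall u \near z, (f u - f w) / (u - w) = phi u.
  move=> zw; apply/nbhsCP; exists (nrm (z - w)); first by rewrite nrm_gt0 subr_eq0.
  move=> u uz; rewrite Hphi mulfK// subr_eq0; apply: contraTneq uz => ->.
  by rewrite nrmB ltxx.
have cq z : z != w -> {for z, continuous f} -> {for z, continuous phi}.
  move=> zw cz; apply: (near_eq_continuousC (phiE z zw)).
  have zw0 : z - w != 0 by rewrite subr_eq0.
  exact: (contCM (contCD cz (contC_cst (- f w) z)) (contCV (f := fun u : C => u - w) zw0
    (contCD (contC_id z) (contC_cst (- w) z)))).
have dq z : z != w -> derivable f z 1 -> derivable phi z 1.
  move=> zw dz; apply: (near_eq_derivableC (phiE z zw)).
  have zw0 : z - w != 0 by rewrite subr_eq0.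
  exact: (derivCM (derivCD dz (derivC_cst (- f w) z)) (derivCV (f := fun u : C => u - w) zw0
    (derivCD (derivC_id z) (derivC_cst (- w) z)))).
have M0 : mean (fun z => z * phi z) (ln r) = 0.
  have -> : mean (fun z => z * phi z) (ln r) = ofR tpi * (0 * phi 0).
    apply: (@mean_center R (fun z => z * phi z) r0 (nrm w) r).
    - by rewrite nw0.
    - exact: rr0.
    - move=> z zr; apply: (contCM (contC_id z)).
      have [->|zw] := eqVneq z w; [exact: cphi|exact: (cq z zw (cf z zr))].
    - move=> z zr zn; apply: (derivCM (derivC_id z)).
      have zw : z != w by apply: contra_neq zn => ->.
      exact: (dq z zw (df z zr)).
  by rewrite mul0r mulr0.
have crn t : circ (ln r) t != w by apply: neq_of_nrm; rewrite nrm_circ lnr.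
have c1 : cont_seg 0 tpi (fun t => f (circ (ln r) t) * (circ (ln r) t / (circ (ln r) t - w))).
  apply: (cont_circ (psi := fun z : C => f z * (z / (z - w)))) => z zr.
  have zw : z != w by apply: neq_of_nrm; rewrite zr lnr.
  have zr0 : nrm z < r0 by rewrite zr lnr.
  exact: (contCM (cf z zr0) (derivable_continuousC (derivC_kernel zw))).
have c2 : cont_seg 0 tpi (fun t => circ (ln r) t / (circ (ln r) t - w)).
  apply: (cont_circ (psi := fun z : C => z / (z - w))) => z zr.
  have zw : z != w by apply: neq_of_nrm; rewrite zr lnr.
  exact: (derivable_continuousC (derivC_kernel zw)).
apply/eqP; rewrite -subr_eq0 -M0 -(mean_kernel r_gt0 wr) mulrC.
rewrite /mean -(cintZ (f w) c2) -(cintB c1 (cont_segZ (c := f w) c2)).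
apply/eqP/eq_cint => t _; set z := circ _ _.
have zw := crn t; have zw0 : z - w != 0 by rewrite subr_eq0.
have -> : phi z = (f z - f w) / (z - w) by rewrite Hphi mulfK.
by field.
Qed.

Lemma circle_bounded f x : (forall z, nrm z = expR x -> {for z, continuous f}) ->
  exists2 M : R, 0 <= M & forall t, 0 <= t <= tpi -> nrm (f (circ x t)) <= M.
Proof.
move=> /cont_circ cc.
have [|c _ Hc] := @EVT_max R (fun t => nrm (f (circ x t))) 0 tpi (ltW (tpi_gt0 R)).
  apply: continuous_in_subspaceT => t; rewrite inE /= in_itv /= => tI.
  apply/cvgrPdist_lt => e e0; have /continuousRCP := cc t tI.
  move=> /(_ _ e0); apply: filterS => u; apply: le_lt_trans.
  rewrite ler_norml lerBlDr lerBrDr addrC lerBlDr.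
  apply/andP; split.
    by have := nrmD (f (circ x u) - f (circ x t)) (f (circ x t)); rewrite subrK addrC.
  have := nrmD (f (circ x t) - f (circ x u)) (f (circ x u)); rewrite subrK.
  by rewrite nrmB.
exists (nrm (f (circ x c))); first exact: nrm_ge0.
by move=> t tI; apply: Hc; rewrite in_itv.
Qed.

Lemma nrm_sub_half (z w : C) (r : R) : nrm z = r -> nrm w <= r / 2 ->
  r / 2 <= nrm (z - w).
Proof. by move=> zr wr; have := nrm_sub_ge z w; rewrite zr; lra. Qed.

(** The kernel is at most 2 on the circle because [nrm w <= r / 2]; the other factor 2 comes from
    [cint_bound]. *)
Lemma cauchy_bound f (r0 r : R) (w : C) (M : R) : 0 < r < r0 ->
  nrm w <= r / 2 ->
  (forall z, nrm z < r0 -> {for z, continuous f}) ->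
  (forall z, 0 < nrm z < r0 -> derivable f z 1) ->
  (forall t, 0 <= t <= tpi -> nrm (f (circ (ln r) t)) <= M) ->
  nrm (f w) <= 4 * M.
Proof.
move=> rr0 wr cf df HM; have /andP[r_gt0 r_lt] := rr0.
have lnr : expR (ln r) = r by rewrite lnK.
have wr' : nrm w < r by lra.
have E := cauchy_formula rr0 wr' cf df.
have c1 : cont_seg 0 tpi (fun t => f (circ (ln r) t) * (circ (ln r) t / (circ (ln r) t - w))).
  apply: (cont_circ (psi := fun z : C => f z * (z / (z - w)))) => z zr.
  have zw : z != w by apply: neq_of_nrm; rewrite zr lnr.
  have zr0 : nrm z < r0 by rewrite zr lnr.
  exact: (contCM (cf z zr0) (derivable_continuousC (derivC_kernel zw))).
have h := cint_bound (M := 2 * M) (ltW (tpi_gt0 R)) c1.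
have {E}h2 := congr1 (@nrm R) E; rewrite nrmM nrm_ofR gtr0_norm ?tpi_gt0// in h2.
suff : tpi * nrm (f w) <= tpi * (4 * M) by rewrite ler_pM2l ?tpi_gt0.
have -> : tpi * (4 * M) = 2 * (2 * M) * (tpi - 0) by ring.
rewrite -h2.
apply: h => t tI; have zr := nrm_circ (ln r) t; rewrite lnr in zr.
have zh := nrm_sub_half zr wr.
rewrite !nrmM nrmV zr mulrC; apply: ler_pM.
- by rewrite divr_ge0 ?nrm_ge0// ltW.
- exact: nrm_ge0.
- by rewrite ler_pdivrMr; lra.
- exact: (HM t tI).
Qed.

(** Expansion of the kernel at 0: [z / (z - w) - 1 - w / z] equals [w ^+ 2 / ((z - w) * z)], so the
    remainder is quadratic in [w]. The Cauchy formula is a hypothesis, in order that uniform limits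
    qualify as well. *)
Lemma cauchy_derivable f (r : R) : 0 < r ->
  (forall z, nrm z = r -> {for z, continuous f}) ->
  (forall w, nrm w < r ->
    mean (fun z : C => f z * (z / (z - w))) (ln r) = ofR tpi * f w) ->
  derivable f 0 1.
Proof.
move=> r0 cf Hf; have lnr : expR (ln r) = r by rewrite lnK.
have [M M0 HM] : exists2 M : R, 0 <= M &
    forall t, 0 <= t <= tpi -> nrm (f (circ (ln r) t)) <= M.
  by apply: circle_bounded => z zr; apply: cf; rewrite zr lnr.
pose A : C := ofR tpi.
have A0 : A != 0 by rewrite -nrm_gt0 nrm_ofR normr_gt0 gt_eqF ?tpi_gt0.
have zn0 t : circ (ln r) t != 0 by rewrite -nrm_gt0 nrm_circ expR_gt0.
have cz : cont_seg 0 tpi (fun t => circ (ln r) t).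
  by apply: (cont_circ (psi := id)) => z _; exact: contC_id.
have cfz : cont_seg 0 tpi (fun t => f (circ (ln r) t)).
  by apply: (cont_circ (psi := f)) => z zr; apply: cf; rewrite zr lnr.
have cV : cont_seg 0 tpi (fun t => (circ (ln r) t)^-1).
  apply: (cont_circ (psi := fun z => z^-1)) => z zr.
  apply: (contCV (f := id)); last exact: contC_id.
  by rewrite -nrm_gt0 zr expR_gt0.
have cK w : nrm w < r -> cont_seg 0 tpi (fun t => circ (ln r) t / (circ (ln r) t - w)).
  move=> wr; apply: (cont_circ (psi := fun z : C => z / (z - w))) => z zr.
  have zw : z != w by apply: neq_of_nrm; rewrite zr lnr.
  exact: (derivable_continuousC (derivC_kernel zw)).
pose L := cint 0 tpi (fun t => f (circ (ln r) t) * (circ (ln r) t)^-1).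
apply/derivable_lip; exists (L / A) => e e0.
(* The remainder will be at most [K * nrm w ^+ 2]: the kernel error is at most
   [2 * nrm w ^+ 2 / r ^+ 2], and [cint_bound] doubles it. *)
pose K := 4 * M / r ^+ 2.
have K0 : 0 <= K by rewrite divr_ge0 ?mulr_ge0 ?exprn_ge0// ltW.
exists (Num.min (r / 2) (e / (K + 1))).
  by rewrite lt_min divr_gt0//= divr_gt0//; lra.
move=> w; rewrite lt_min subr0 => /andP[wr we].
have wr' : nrm w < r by lra.
have n0r : nrm (0 : C) < r by rewrite nrm0.
suff H : nrm (A * (f w - f 0 - L / A * w)) <= nrm A * (e * nrm w).
  by move: H; rewrite nrmM ler_pM2l// nrm_gt0.
have -> : A * (f w - f 0 - L / A * w) = A * f w - A * f 0 - w * L.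
  by field.
have cfK u (ur : nrm u < r) := cont_segM cfz (cK u ur).
rewrite -!Hf// -(cintZ w (cont_segM cfz cV)) /mean.
rewrite -(cintB (cfK _ wr') (cfK _ n0r)).
rewrite -(cintB (cont_segB (cfK _ wr') (cfK _ n0r)) (cont_segZ (c := w) (cont_segM cfz cV))).
have := cint_bound (M := M * (2 * nrm w ^+ 2 / r ^+ 2)) (ltW (tpi_gt0 R))
  (cont_segB (cont_segB (cfK _ wr') (cfK _ n0r)) (cont_segZ (c := w) (cont_segM cfz cV))).
move=> h; apply: le_trans (h _) _.
  move=> t tI; set z := circ _ _; have zr : nrm z = r by rewrite nrm_circ lnr.
  have zw : z - w != 0 by rewrite subr_eq0; apply: neq_of_nrm; rewrite zr.
  have z0 : z != 0 := zn0 t.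
  have -> : f z * (z / (z - w)) - f z * (z / (z - 0)) - w * (f z * z^-1) =
      f z * (w ^+ 2 / ((z - w) * z)).
    by rewrite subr0; field; rewrite ?z0 ?zw.
  rewrite nrmM; apply: ler_pM; rewrite ?nrm_ge0 ?HM//.
  rewrite nrmM nrmX nrmV nrmM zr.
  have zh : r / 2 <= nrm (z - w) by apply: nrm_sub_half => //; exact: ltW.
  rewrite [2 * _]mulrC -[leRHS]mulrA; apply: ler_wpM2l; first by rewrite exprn_ge0 ?nrm_ge0.
  have -> : 2 / r ^+ 2 = (r / 2 * r)^-1 by field; rewrite gt_eqF.
  rewrite lef_pV2 ?posrE ?ler_pM2r// mulr_gt0//; lra.
rewrite nrm_ofR gtr0_norm ?tpi_gt0// subr0.
have -> : 2 * (M * (2 * nrm w ^+ 2 / r ^+ 2)) * tpi = tpi * (K * nrm w * nrm w).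
  by rewrite /K; field; rewrite gt_eqF.
rewrite ler_pM2l ?tpi_gt0// ler_wpM2r ?nrm_ge0//.
have : nrm w * (K + 1) <= e by rewrite -ler_pdivlMr ?(ltW we)//; lra.
have := nrm_ge0 w; rewrite mulrDr mulr1 mulrC; lra.
Qed.

Lemma derivable_shift f (a z : C) :
  derivable f (a + z) 1 <-> derivable (fun u : C => f (a + u)) z 1.
Proof.
split=> d; first exact: (derivC_comp (derivCD (derivC_cst a z) (derivC_id z)) d).
have := @derivC_comp R (fun u => u - a) (fun u => f (a + u)) (a + z).
rewrite [a + z - a]addrAC subrr add0r => /(_ _ d) h.
have -> : f = (fun w => f (a + (w - a))) by apply/funext => w; rewrite addrC subrK.
by apply: h; exact: (derivCD (derivC_id _) (derivC_cst (- a) _)).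
Qed.

Lemma continuous_shiftC f (a z : C) : {for a + z, continuous f} ->
  {for z, continuous (fun u : C => f (a + u))}.
Proof.
move=> c; exact: (contC_comp (contCD (contC_cst a z) (contC_id z)) c).
Qed.

Theorem removable_singularity f (a : C) :
  (\forall z \near a^', derivable f z 1) -> {for a, continuous f} ->
  derivable f a 1.
Proof.
move=> /dnbhsCP[r r0 Hr] ca; rewrite -[a]addr0; apply/derivable_shift.
have dg z : 0 < nrm z < r -> derivable (fun u : C => f (a + u)) z 1.
  move=> /andP[z0 zr]; apply/derivable_shift; apply: Hr; last by rewrite addrAC subrr add0r.
  by rewrite -subr_eq0 addrAC subrr add0r -nrm_gt0.
have cg z : nrm z < r -> {for z, continuous (fun u : C => f (a + u))}.
  move=> zr; have [->|z0] := eqVneq z 0.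
    by apply: continuous_shiftC; rewrite addr0.
  by apply/derivable_continuousC/dg; rewrite nrm_gt0 z0.
apply: (@cauchy_derivable _ (r / 2)); first by lra.
  by move=> z zr; apply: cg; lra.
move=> w wr; apply: (@cauchy_formula _ r); [by lra|exact: wr|exact: cg|exact: dg].
Qed.

(* Weierstrass: a uniform limit of holomorphic functions satisfies the Cauchy
   formula. *)
Theorem uniform_limit_derivable f (a : C) (r : R) : 0 < r ->
  (forall e : R, 0 < e -> exists2 g : C -> C,
     forall z, nrm (z - a) < r -> derivable g z 1 &
     forall z, nrm (z - a) < r -> nrm (f z - g z) <= e) ->
  derivable f a 1.
Proof.
move=> r0 H; rewrite -[a]addr0; apply/derivable_shift.
pose F u := f (a + u).
have HF e : 0 < e -> exists2 g : C -> C, forall z, nrm z < r -> derivable g z 1 &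
     forall z, nrm z < r -> nrm (F z - g z) <= e.
  move=> /H[g dg fg]; exists (fun u => g (a + u)) => z zr.
    by apply/derivable_shift; apply: dg; rewrite addrAC subrr add0r.
  by apply: fg; rewrite addrAC subrr add0r.
have cF z : nrm z < r -> {for z, continuous F}.
  move=> zr; apply/continuousCP => e e0; have e4 : 0 < e / 4 by lra.
  have [g dg Fg] := HF _ e4.
  have /derivable_continuousC/continuousCP := dg z zr.
  move=> /(_ _ e4)[d d0 Hd]; exists (Num.min d (r - nrm z)).
    by rewrite lt_min d0 subr_gt0.
  move=> w; rewrite lt_min => /andP[wd wr].
  have wr' : nrm w < r by have := nrmD (w - z) z; rewrite subrK; lra.
  have h1 := Hd w wd; have h2 := Fg w wr'; have h3 := Fg z zr.
  have h4 := nrmBD (g w) (F w) (F z); have h5 := nrmBD (g z) (g w) (F z).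
  by rewrite [nrm (g z - F z)]nrmB in h5; lra.
have r2 : 0 < r / 2 by lra.
have lnr : expR (ln (r / 2)) = r / 2 by rewrite lnK.
apply: (@cauchy_derivable F (r / 2)); [exact: r2|by move=> z zr; apply: cF; lra|].
move=> w wr.
apply/eqP; rewrite -subr_eq0; apply/eqP.
(* A bound for the kernel on the circle of radius [r / 2]. *)
pose K := r / 2 / (r / 2 - nrm w).
have K0 : 0 <= K by rewrite divr_ge0; lra.
apply: (@nrm_small0 _ _ ((2 * K + 1) * tpi)) => e e0.
have [g dg Fg] := HF _ e0.
have cg z : nrm z < r -> {for z, continuous g}.
  by move=> zr; exact: (derivable_continuousC (dg z zr)).
have Cg : mean (fun z => g z * (z / (z - w))) (ln (r / 2)) = ofR tpi * g w.
  apply: (@cauchy_formula g r (r / 2)); [by lra|exact: wr|exact: cg|].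
  by move=> z /andP[_ zr]; exact: (dg z zr).
have cK : cont_seg 0 tpi (fun t => circ (ln (r / 2)) t / (circ (ln (r / 2)) t - w)).
  apply: (cont_circ (psi := fun z : C => z / (z - w))) => z zr.
  have zw : z != w by apply: neq_of_nrm; rewrite zr lnr.
  exact: (derivable_continuousC (derivC_kernel zw)).
have cFc : cont_seg 0 tpi (fun t => F (circ (ln (r / 2)) t)).
  by apply: (cont_circ (psi := F)) => z zr; apply: cF; rewrite zr lnr; lra.
have cgc : cont_seg 0 tpi (fun t => g (circ (ln (r / 2)) t)).
  by apply: (cont_circ (psi := g)) => z zr; apply: cg; rewrite zr lnr; lra.
have wr' : nrm w < r by lra.
have -> : mean (fun z => F z * (z / (z - w))) (ln (r / 2)) - ofR tpi * F w =
   (mean (fun z => F z * (z / (z - w))) (ln (r / 2)) -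
   mean (fun z => g z * (z / (z - w))) (ln (r / 2))) - ofR tpi * (F w - g w).
  by rewrite Cg; ring.
apply: le_trans (nrmD _ _) _; rewrite nrmN nrmM nrm_ofR gtr0_norm ?tpi_gt0//.
rewrite /mean -(cintB (cont_segM cFc cK) (cont_segM cgc cK)).
have := cint_bound (M := e * K) (ltW (tpi_gt0 R))
  (cont_segB (cont_segM cFc cK) (cont_segM cgc cK)).
rewrite subr0 => h.
have -> : (2 * K + 1) * tpi * e = 2 * (e * K) * tpi + tpi * e by ring.
apply: lerD; last by rewrite ler_pM2l ?tpi_gt0// Fg.
apply: h => t _; rewrite -mulrBl nrmM.
have zr := nrm_circ (ln (r / 2)) t; rewrite lnr in zr.
apply: ler_pM; rewrite ?nrm_ge0//; first by apply: Fg; rewrite zr; lra.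
rewrite nrmM nrmV zr /K; apply: ler_wpM2l; first lra.
have := nrm_sub_ge (circ (ln (r / 2)) t) w; rewrite zr => hz.
by rewrite lef_pV2 ?posrE; lra.
Qed.

End CauchyFormula.

(** * Zeros, poles and analytic continuation *)

Section LocalTheory.
Variable R : realType.
Local Notation C := (Cplx R).
Local Notation tpi := (pi *+ 2 : R).
Implicit Types f g h : C -> C.

Lemma nbhsC_S (a : C) (A B : set C) : (forall z, A z -> B z) ->
  (\forall z \near a, A z) -> \forall z \near a, B z.
Proof. by move=> H /nbhsCP[d d0 Hd]; apply/nbhsCP; exists d => // z /Hd/H. Qed.

Lemma nbhsC_S2 (a : C) (A B D : set C) : (forall z, A z -> B z -> D z) ->
  (\forall z \near a, A z) -> (\forall z \near a, B z) -> \forall z \near a, D z.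
Proof.
move=> H /nbhsCP[d d0 Hd] /nbhsCP[r r0 Hr]; apply/nbhsCP.
exists (Num.min d r); first by rewrite lt_min d0.
by move=> z; rewrite lt_min => /andP[/Hd zA /Hr zB]; exact: H.
Qed.

Lemma dnbhsC_S (a : C) (A B : set C) : (forall z, A z -> B z) ->
  (\forall z \near a^', A z) -> \forall z \near a^', B z.
Proof.
by move=> H /dnbhsCP[d d0 Hd]; apply/dnbhsCP; exists d => // z za /(Hd z za)/H.
Qed.

Lemma dnbhs_filterS2 (a : C) (A B D : set C) : (forall z, A z -> B z -> D z) ->
  (\forall z \near a^', A z) -> (\forall z \near a^', B z) ->
  \forall z \near a^', D z.
Proof.
move=> H /dnbhsCP[d d0 Hd] /dnbhsCP[r r0 Hr]; apply/dnbhsCP.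
exists (Num.min d r); first by rewrite lt_min d0.
move=> z za; rewrite lt_min => /andP[/(Hd z za) zA /(Hr z za) zB]; exact: H.
Qed.

Definition derivable_disc f (a : C) (r : R) :=
  forall z, nrm (z - a) < r -> derivable f z 1.

Lemma holomorphic_discP f a :
  holomorphic_at f a <-> exists2 r : R, 0 < r & derivable_disc f a r.
Proof. exact: nbhsCP. Qed.

Lemma continuous_derivable_disc f a r : 0 < r ->
  (forall z, z != a -> nrm (z - a) < r -> derivable f z 1) ->
  {for a, continuous f} -> derivable_disc f a r.
Proof.
move=> r0 H ca z zr; have [->|za] := eqVneq z a; last exact: H.
apply: (removable_singularity _ ca); apply/dnbhsCP; exists r => // u; exact: H.
Qed.

(** The quotient is the Caratheodory factor of [f] at [a]; it is continuous there, so its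
    singularity is removable. The radius is not reduced, so that the division can be repeated
    indefinitely on one disc. *)
Lemma factor_disc f a r : 0 < r -> derivable_disc f a r -> f a = 0 ->
  exists h, derivable_disc h a r /\ forall z, f z = (z - a) * h z.
Proof.
move=> r0 df fa0; have daf : derivable f a 1 by apply: df; rewrite subrr nrm0.
have /derivableCP[h [ch Hh]] := daf; exists h; split; last first.
  by move=> z; rewrite mulrC -Hh fa0 subr0.
apply: (continuous_derivable_disc r0 _ ch) => z za zr.
have E : \forall u \near z, f u / (u - a) = h u.
  apply/nbhsCP; exists (nrm (z - a)); first by rewrite nrm_gt0 subr_eq0.
  move=> u uz; rewrite -[f u]subr0 -fa0 Hh mulfK// subr_eq0.
  by apply: contraTneq uz => ->; rewrite nrmB ltxx.
apply: (near_eq_derivableC E); have za0 : z - a != 0 by rewrite subr_eq0.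
exact: (derivCM (df z zr) (derivCV (f := fun u : C => u - a) za0
  (derivCD (derivC_id z) (derivC_cst (- a) z)))).
Qed.

(** If [M] bounds [f] on the circle of radius [r / 2], then [M / (r / 2) ^+ n] bounds [h] there, and
    Cauchy's estimate makes [f] at most [4 * M / 2 ^+ n] on the disc of radius [r / 4], for every
    [n]. *)
Lemma flat_disc f a r : 0 < r -> derivable_disc f a r ->
  (forall n, exists h, derivable_disc h a r /\
     forall z, f z = (z - a) ^+ n * h z) ->
  forall z, nrm (z - a) <= r / 4 -> f z = 0.
Proof.
move=> r0 df H z zr.
pose F u := f (a + u); have r2 : 0 < r / 2 by lra.
have lnr : expR (ln (r / 2)) = r / 2 by rewrite lnK.
have shift_disc (h : C -> C) : derivable_disc h a r ->
    forall u, nrm u < r -> derivable (fun u : C => h (a + u)) u 1.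
  move=> dh u ur; apply/derivable_shift; apply: dh.
  by rewrite addrAC subrr add0r.
have cF u : nrm u = expR (ln (r / 2)) -> {for u, continuous F}.
  move=> ur; apply/derivable_continuousC/(shift_disc f df u).
  by rewrite ur lnr; lra.
have [M M0 HM] := circle_bounded cF.
apply: (@nrm_small0 _ _ 1) => e e0; rewrite mul1r.
have [n Hn] := ex_small_pow (4 * M) e0.
have [h [dh fh]] := H n.
pose G u := h (a + u).
have dG u : nrm u < r -> derivable G u 1 by exact: shift_disc.
have cG u : nrm u < r -> {for u, continuous G}.
  by move=> ur; exact: (derivable_continuousC (dG u ur)).
have rr : 0 < r / 2 < r by lra.
have zr4 : nrm (z - a) <= r / 2 / 2 by lra.
have dG' u : 0 < nrm u < r -> derivable G u 1 by move=> /andP[_]; exact: dG.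
have := cauchy_bound (f := G) (M := M / (r / 2) ^+ n) rr zr4 cG dG'.
have -> : G (z - a) = h z by rewrite /G addrC subrK.
move=> hb; rewrite fh nrmM nrmX.
apply: le_trans (ltW Hn).
have hz : nrm (h z) <= 4 * (M / (r / 2) ^+ n).
  apply: hb => t tI; have := HM t tI; rewrite /F fh addrAC subrr add0r -/(G _).
  rewrite nrmM nrmX nrm_circ lnr ler_pdivlMr ?exprn_gt0// mulrC.
  by rewrite /G.
apply: (@le_trans _ _ ((r / 2 / 2) ^+ n * (4 * (M / (r / 2) ^+ n)))).
  apply: ler_pM => //; rewrite ?nrm_ge0 ?exprn_ge0 ?nrm_ge0//.
  by apply: lerXn2r => //; rewrite ?nnegrE ?nrm_ge0//; lra.
have key (A B : R) : A != 0 -> B != 0 -> A / B * (4 * (M / A)) = 4 * M / B.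
  by move=> A0 B0; field; rewrite A0 B0.
rewrite [X in X * _]expr_div_n key ?lexx// expf_neq0 ?pnatr_eq0//.
by rewrite gt_eqF.
Qed.

(** Division by [z - a] either stops at a nonzero value or goes on forever, which is the case of
    [flat_disc]. *)
Lemma zero_order_disc f a r : 0 < r -> derivable_disc f a r ->
  (forall z, nrm (z - a) <= r / 4 -> f z = 0) \/
  exists n h, [/\ derivable_disc h a r, h a != 0 &
    forall z, f z = (z - a) ^+ n * h z].
Proof.
move=> r0 df; have [|nE] := pselect (exists n h, [/\ derivable_disc h a r,
  h a != 0 & forall z, f z = (z - a) ^+ n * h z]); first by right.
left; apply: (flat_disc r0 df); elim=> [|n [h [dh fh]]].
  by exists f; split=> // z; rewrite expr0 mul1r.
have [ha|ha] := eqVneq (h a) 0; last by case: nE; exists n, h.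
have [k [dk hk]] := factor_disc r0 dh ha.
by exists k; split=> // z; rewrite fh hk exprSr mulrA.
Qed.

(** * Operations on holomorphic germs *)

Lemma hol_continuous f a : holomorphic_at f a -> {for a, continuous f}.
Proof. by move=> /nbhs_singleton; exact: derivable_continuousC. Qed.

Lemma holM f g a : holomorphic_at f a -> holomorphic_at g a ->
  holomorphic_at (fun z => f z * g z) a.
Proof. by apply: nbhsC_S2 => z df dg; exact: (derivCM df dg). Qed.

Lemma holD f g a : holomorphic_at f a -> holomorphic_at g a ->
  holomorphic_at (fun z => f z + g z) a.
Proof. by apply: nbhsC_S2 => z df dg; exact: (derivCD df dg). Qed.

Lemma hol_cst (c : C) a : holomorphic_at (fun=> c) a.
Proof. by apply/nbhsCP; exists 1 => // z _; exact: derivC_cst. Qed.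

Lemma holX f n a : holomorphic_at f a -> holomorphic_at (fun z => f z ^+ n) a.
Proof. by apply: nbhsC_S => z df; exact: (derivCX (n := n) df). Qed.

Lemma hol_subX (b : C) n a : holomorphic_at (fun z => (z - b) ^+ n) a.
Proof.
apply/nbhsCP; exists 1 => // z _.
exact: (derivCX (f := fun z : C => z - b) (n := n)
  (derivCD (derivC_id z) (derivC_cst (- b) z))).
Qed.

Lemma near_continuous_neq0 f a : {for a, continuous f} -> f a != 0 ->
  \forall z \near a, f z != 0.
Proof.
move=> /continuousCP H; rewrite -nrm_gt0 => fa.
have [d d0 Hd] := H _ fa; apply/nbhsCP; exists d => // z /Hd.
by apply: contraTneq => ->; rewrite sub0r nrmN ltxx.
Qed.

Lemma holV f a : holomorphic_at f a -> f a != 0 ->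
  holomorphic_at (fun z => (f z)^-1) a.
Proof.
move=> hf fa; have := near_continuous_neq0 (hol_continuous hf) fa.
by apply: (nbhsC_S2 _ hf) => z df f0; exact: (derivCV f0 df).
Qed.

Lemma near_scale (c a : C) (A : set C) : (\forall z \near (c * a), A z) ->
  \forall z \near a, A (c * z).
Proof.
move=> nA; have : {for a, continuous (fun z : C => c * z)}.
  exact: (contCM (contC_cst c a) (contC_id a)).
by move=> /(_ _ nA).
Qed.

Lemma hol_scale f (c a : C) : holomorphic_at f (c * a) ->
  holomorphic_at (fun z => f (c * z)) a.
Proof.
move=> /near_scale; apply: nbhsC_S => z df.
exact: (derivC_comp (f := fun z : C => c * z)
  (derivCM (derivC_cst c z) (derivC_id z)) df).
Qed.

Lemma dnbhs_scale (c a : C) (A : set C) : c != 0 ->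
  (\forall z \near (c * a)^', A z) -> \forall z \near a^', A (c * z).
Proof.
move=> c0 H; have := near_scale (A := fun z => z != c * a -> A z) H.
move=> /nbhsCP[d d0 Hd]; apply/dnbhsCP; exists d => // z za zd.
by apply: (Hd z zd); rewrite (inj_eq (mulfI c0)).
Qed.

Lemma dnbhs_neq (a : C) : \forall z \near a^', z != a.
Proof. by apply/dnbhsCP; exists 1. Qed.

Lemma nbhs_dnbhsC (a : C) (A : set C) :
  (\forall z \near a, A z) -> \forall z \near a^', A z.
Proof. by move=> /nbhsCP[d d0 H]; apply/dnbhsCP; exists d => // z _; exact: H. Qed.

Lemma dnbhs_ex (a : C) (A : set C) : (\forall z \near a^', A z) ->
  exists2 z, z != a & A z.
Proof.
move=> /dnbhsCP[d d0 H]; pose z := a + ofR (d / 2).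
have zE : z - a = ofR (d / 2) by rewrite addrAC subrr add0r.
have za : z != a.
  by rewrite -subr_eq0 zE -nrm_gt0 nrm_ofR normr_gt0; lra.
exists z => //; apply: H => //; rewrite zE nrm_ofR gtr0_norm; lra.
Qed.

Lemma continuous_dnbhs0 f a : {for a, continuous f} ->
  (\forall z \near a^', f z = 0) -> f a = 0.
Proof.
move=> /continuousCP H Hz; apply: (@nrm_small0 _ _ 1) => e e0; rewrite mul1r.
have [d d0 Hd] := H e e0.
have nd : \forall z \near a^', nrm (z - a) < d by apply/dnbhsCP; exists d.
have [z _ [za fz]] := dnbhs_ex (dnbhs_filterS2 (fun _ => @conj _ _) nd Hz).
by have := Hd z za; rewrite fz sub0r nrmN => /ltW.
Qed.

(** * Meromorphic germs and their orders *)

Definition flat f a := \forall z \near a^', f z = 0.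

(** Weaker than being holomorphic or having a pole: the value at [a] is ignored, so that sums,
    products and quotients formed pointwise stay in the class. *)
Definition mero f (a : C) := exists n h, holomorphic_at h a /\
  \forall z \near a^', f z = h z / (z - a) ^+ n.

Definition ord f (a : C) (k : int) := exists h, [/\ holomorphic_at h a,
  h a != 0 & \forall z \near a^', f z = h z * (z - a) ^ k].

Lemma hol_mero f a : holomorphic_at f a -> mero f a.
Proof.
by move=> hf; exists 0%N, f; split=> //; apply/dnbhsCP; exists 1 => // z _ _;
  rewrite expr0 divr1.
Qed.

Lemma pole_ord n f a : pole_of_order n f a -> ord f a (- n%:Z).
Proof.
move=> [_ [h [hh ha E]]]; exists h; split=> //.
by apply: (dnbhsC_S _ E) => z ->; rewrite exprnN.
Qed.

Lemma ord_mero f a k : ord f a k -> mero f a.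
Proof.
move=> [h [hh ha E]]; case: k E => [n|n] E.
  exists 0%N, (fun z => h z * (z - a) ^+ n).
  split; first exact: (holM hh (hol_subX a n a)).
  by apply: (dnbhsC_S _ E) => z H; rewrite expr0 divr1 H.
by exists n.+1, h.
Qed.

Lemma flat_mero f a : flat f a -> mero f a.
Proof.
move=> ff; exists 0%N, (fun=> 0); split; first exact: hol_cst.
by apply: (dnbhsC_S _ ff) => z H; rewrite H// mul0r.
Qed.

Lemma meroP f a : mero f a -> flat f a \/ exists k, ord f a k.
Proof.
move=> [n [h [/holomorphic_discP[r r0 dh] E]]].
have [hz|[m [k [dk ka hk]]]] := zero_order_disc r0 dh.
  left; have nr : \forall z \near a^', nrm (z - a) < r / 4.
    by apply/dnbhsCP; exists (r / 4) => //; lra.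
  apply: (dnbhs_filterS2 _ E nr) => z -> zr.
  by rewrite hz ?mul0r// ltW.
right; exists (m%:Z - n%:Z), k; split=> //.
  by apply/holomorphic_discP; exists r.
apply: (dnbhs_filterS2 _ E (dnbhs_neq a)) => z -> za.
by rewrite hk expfzDr ?subr_eq0// exprnN mulrA [k z * _]mulrC.
Qed.

Lemma pole_mero n f a : pole_of_order n f a -> mero f a.
Proof. by move=> /pole_ord/ord_mero. Qed.

Lemma meromorphic_mero D f a : meromorphic_on D f -> D a -> mero f a.
Proof. by move=> H /H[/hol_mero//|[n /pole_mero]]. Qed.

Lemma eq_mero f g a : (\forall z \near a^', f z = g z) -> mero f a -> mero g a.
Proof.
move=> E [n [h [hh H]]]; exists n, h; split=> //.
by apply: (dnbhs_filterS2 _ E H) => z ->.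
Qed.

Lemma eq_ord f g a k : (\forall z \near a^', f z = g z) ->
  ord f a k -> ord g a k.
Proof.
move=> E [h [hh ha H]]; exists h; split=> //.
by apply: (dnbhs_filterS2 _ E H) => z ->.
Qed.

Lemma meroM f g a : mero f a -> mero g a -> mero (fun z => f z * g z) a.
Proof.
move=> [n [h [hh E]]] [m [k [hk F]]]; exists (n + m)%N, (fun z => h z * k z).
split; first exact: (holM hh hk).
by apply: (dnbhs_filterS2 _ E F) => z -> ->; rewrite exprD invfM mulrACA.
Qed.

Lemma meroD f g a : mero f a -> mero g a -> mero (fun z => f z + g z) a.
Proof.
move=> [n [h [hh E]]] [m [k [hk F]]].
exists (n + m)%N, (fun z => h z * (z - a) ^+ m + k z * (z - a) ^+ n); split.
  exact: (holD (holM hh (hol_subX a m a)) (holM hk (hol_subX a n a))).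
apply: (dnbhs_filterS2 _ (dnbhs_filterS2 (fun _ => @conj _ _) E F) (dnbhs_neq a)).
move=> z [-> ->] za; have za0 : z - a != 0 by rewrite subr_eq0.
by rewrite exprD; field; rewrite !expf_neq0.
Qed.

Lemma mero_cst (c : C) a : mero (fun=> c) a.
Proof. exact/hol_mero/hol_cst. Qed.

Lemma meroB f g a : mero f a -> mero g a -> mero (fun z => f z - g z) a.
Proof.
move=> mf mg; have := meroD mf (meroM (mero_cst (- 1) a) mg).
by apply: eq_mero; apply/dnbhsCP; exists 1 => // z _ _; rewrite mulN1r.
Qed.

Lemma ordV f a k : ord f a k -> ord (fun z => (f z)^-1) a (- k).
Proof.
move=> [h [hh ha E]]; exists (fun z => (h z)^-1); split.
- exact: (holV hh ha).
- by rewrite invr_eq0.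
- by apply: (dnbhsC_S _ E) => z H; rewrite H// invfM invr_expz.
Qed.

(** The inverse of a flat germ is flat, as [0^-1 = 0]; otherwise the order changes sign. *)
Lemma meroV f a : mero f a -> mero (fun z => (f z)^-1) a.
Proof.
move=> /meroP[ff|[k /ordV/ord_mero//]]; apply: flat_mero.
by apply: (dnbhsC_S _ ff) => z H; rewrite H// invr0.
Qed.

Lemma meroX f n a : mero f a -> mero (fun z => f z ^+ n) a.
Proof.
move=> mf; elim: n => [|n IH]; first exact: mero_cst.
have := meroM mf IH; apply: eq_mero.
by apply/dnbhsCP; exists 1 => // z _ _; rewrite exprS.
Qed.

Lemma mero_prod (I : Type) (s : seq I) (Q : pred I) (F : I -> C -> C) a :
  (forall i, Q i -> mero (F i) a) -> mero (fun z => \prod_(i <- s | Q i) F i z) a.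
Proof.
move=> H; elim: s => [|i s IH].
  apply: (eq_mero _ (mero_cst 1 a)).
  by apply/dnbhsCP; exists 1 => // z _ _; rewrite big_nil.
case Qi: (Q i).
  apply: (eq_mero _ (meroM (H i Qi) IH)).
  by apply/dnbhsCP; exists 1 => // z _ _; rewrite big_cons Qi.
apply: (eq_mero _ IH).
by apply/dnbhsCP; exists 1 => // z _ _; rewrite big_cons Qi.
Qed.

Lemma mero_scale f (c a : C) : c != 0 -> mero f (c * a) ->
  mero (fun z => f (c * z)) a.
Proof.
move=> c0 [n [h [hh E]]]; exists n, (fun z => h (c * z) / c ^+ n); split.
  exact: (holM (hol_scale hh) (hol_cst _ a)).
apply: (dnbhs_filterS2 _ (dnbhs_scale c0 E) (dnbhs_neq a)) => z -> za.
rewrite -mulrBr exprMn; field.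
by rewrite !expf_neq0 ?subr_eq0.
Qed.

Lemma ordM f g a j k : ord f a j -> ord g a k ->
  ord (fun z => f z * g z) a (j + k).
Proof.
move=> [h [hh ha E]] [l [hl la F]]; exists (fun z => h z * l z); split.
- exact: (holM hh hl).
- by rewrite mulf_neq0.
- apply: (dnbhs_filterS2 _ (dnbhs_filterS2 (fun _ => @conj _ _) E F) (dnbhs_neq a)).
  by move=> z [-> ->] za; rewrite expfzDr ?subr_eq0// mulrACA.
Qed.

Lemma hol_ord0 f a : holomorphic_at f a -> f a != 0 -> ord f a 0.
Proof.
move=> hf fa; exists f; split=> //; apply/dnbhsCP; exists 1 => // z _ _.
by rewrite expr0z mulr1.
Qed.

Lemma ordX f a k n : ord f a k -> ord (fun z => f z ^+ n) a (k * n%:Z).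
Proof.
move=> of_; elim: n => [|n IH].
  by rewrite mulr0; apply: hol_ord0; [exact: hol_cst|exact: oner_neq0].
have -> : k * n.+1%:Z = k + k * n%:Z by rewrite intS mulrDr mulr1.
apply: (eq_ord _ (ordM of_ IH)).
by apply/dnbhsCP; exists 1 => // z _ _; rewrite exprS.
Qed.

Lemma ord_scale f (c a : C) k : c != 0 -> ord f (c * a) k ->
  ord (fun z => f (c * z)) a k.
Proof.
move=> c0 [h [hh ha E]]; exists (fun z => h (c * z) * c ^ k); split.
- exact: (holM (hol_scale hh) (hol_cst _ a)).
- by rewrite mulf_neq0// expfz_neq0.
- apply: (dnbhs_filterS2 _ (dnbhs_scale c0 E) (dnbhs_neq a)) => z -> za.
  by rewrite -mulrBr expfzMl mulrA.
Qed.

Lemma ord_neq0 f a k : ord f a k -> \forall z \near a^', f z != 0.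
Proof.
move=> [h [hh ha E]].
have h0 := nbhs_dnbhsC (near_continuous_neq0 (hol_continuous hh) ha).
apply: (dnbhs_filterS2 _ (dnbhs_filterS2 (fun _ => @conj _ _) E h0) (dnbhs_neq a)).
by move=> z [-> hz] za; rewrite mulf_neq0// expfz_neq0// subr_eq0.
Qed.

Lemma ord_not_flat f a k : ord f a k -> ~ flat f a.
Proof.
move=> /ord_neq0 H /(dnbhs_filterS2 (fun _ => @conj _ _) H)/dnbhs_ex[z _ [/eqP]].
by [].
Qed.

(** If [j < k], then [h] equals [l z * (z - a) ^ (k - j)] off [a], and continuity forces
    [h a = 0]. *)
Lemma ord_uniq f a j k : ord f a j -> ord f a k -> j = k.
Proof.
wlog : j k / j < k => [W oj ok|jk [h [hh ha E]] [l [hl la F]]].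
  by have [jk|kj|//] := ltgtP j k; [exact: W|apply/esym/W].
case kE: (k - j) (subr_gt0 j k) => [[|n]|n]; rewrite jk// => _.
suff : h a - l a * (a - a) ^+ n.+1 = 0.
  by rewrite subrr expr0n mulr0 subr0 => h0; rewrite h0 eqxx in ha.
apply: (continuous_dnbhs0 (f := fun z => h z - l z * (z - a) ^+ n.+1)).
  exact: (contCD (hol_continuous hh)
    (contCN (hol_continuous (holM hl (hol_subX a n.+1 a))))).
apply: (dnbhs_filterS2 _ (dnbhs_filterS2 (fun _ => @conj _ _) E F) (dnbhs_neq a)).
move=> z [-> H] za; have za0 : z - a != 0 by rewrite subr_eq0.
have jz : (z - a) ^ j != 0 by rewrite expfz_neq0.
apply: (mulIf jz); rewrite mul0r mulrBl H -mulrA.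
have -> : (z - a) ^+ n.+1 * (z - a) ^ j = (z - a) ^ k.
  by rewrite exprnP -kE -expfzDr// subrK.
by rewrite subrr.
Qed.

(** * The identity principle on convex sets *)

Definition segment_closed (D : set C) := forall a b (t : R), D a -> D b ->
  0 <= t <= 1 -> D (a + ofR t * (b - a)).

(** Zeros are isolated unless the germ is flat, so flatness is both an open and a closed
    condition. *)
Lemma mero_dichotomy f a : mero f a -> exists2 d : R, 0 < d &
  (forall p, nrm (p - a) < d -> flat f p) \/
  (forall p, nrm (p - a) < d -> ~ flat f p).
Proof.
(* Close to any [p] of the disc, points other than [p] avoid [a] and stay in the disc, so a property
   of the punctured disc at [a] holds on a punctured neighbourhood of [p]. *)
have punct d p : 0 < d -> nrm (p - a) < d ->
    \forall z \near p^', z != a /\ nrm (z - a) < d.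
  move=> d0 pd; have [->|pa] := eqVneq p a; first by apply/dnbhsCP; exists d.
  apply/nbhs_dnbhsC/nbhsCP.
  exists (Num.min (nrm (p - a)) (d - nrm (p - a))).
    by rewrite lt_min nrm_gt0 !subr_eq0 pa subr_gt0.
  move=> z; rewrite lt_min => /andP[z1 z2]; split.
    by apply: contraTneq z1 => ->; rewrite nrmB ltxx.
  by have := nrmBD p z a; lra.
move=> /meroP[/dnbhsCP[d d0 H]|[k /ord_neq0/dnbhsCP[d d0 H]]]; exists d => //.
  by left=> p /(punct d p d0); apply: dnbhsC_S => z [? ?]; exact: H.
right=> p /(punct d p d0) np fp.
have [z _ [[za zd] fz]] := dnbhs_ex (dnbhs_filterS2 (fun _ => @conj _ _) np fp).
by have := H z za zd; rewrite fz eqxx.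
Qed.

(** Connectedness of the segment from [a] to [b], through the supremum of the parameters up to which
    [f] is flat. *)
Theorem mero_identity (D : set C) f a b : segment_closed D ->
  (forall z, D z -> mero f z) -> D a -> D b -> flat f a -> flat f b.
Proof.
move=> sD mf Da Db fa; pose gam (t : R) : C := a + ofR t * (b - a).
have gamD t u : nrm (gam u - gam t) = `|u - t| * nrm (b - a).
  have -> : gam u - gam t = ofR (u - t) * (b - a).
    by rewrite /gam ofRD ofRN; ring.
  by rewrite nrmM nrm_ofR.
pose S : set R := [set t | 0 <= t <= 1 /\ forall u, 0 <= u <= t -> flat f (gam u)].
have S0 : S 0.
  split=> [|u /le_anti <-]; first by lra.
  by rewrite /gam -[ofR 0]/(0 : C) mul0r addr0.
have Sub : ubound S 1 by move=> t [/andP[]].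
have Ssup : has_sup S by split; [exists 0|exists 1].
have Sdown t u : S t -> 0 <= u <= t -> S u.
  move=> [/andP[t0 t1] Ht] /andP[u0 ut]; split; first lra.
  by move=> v /andP[v0 vu]; apply: Ht; lra.
pose s := sup S.
have s0 : 0 <= s by apply: ub_le_sup => //; exists 1.
have s1 : s <= 1 by apply: ge_sup => //; exists 0.
have [|d d0 Hd] := mero_dichotomy (mf (gam s) _); first by apply: sD => //; lra.
pose del := d / (nrm (b - a) + 1).
have nb := nrm_ge0 (b - a).
have del0 : 0 < del by rewrite divr_gt0//; lra.
have close u : `|u - s| < del -> nrm (gam u - gam s) < d.
  rewrite gamD ltr_pdivlMr; last by lra.
  apply: le_lt_trans; rewrite ler_wpM2l//; lra.
(* Some element of [S] lies close to [s], which excludes the second alternative at [gam s]. *)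
have [t St ts] : exists2 t, S t & s - del < t.
  by have [t St ts] := sup_adherent del0 Ssup; exists t.
have ts' : t <= s by apply: ub_le_sup => //; exists 1.
case: Hd => Hd; last first.
  case: (Hd (gam t)); first by apply: close; rewrite ltr_norml; lra.
  by case: St => /andP[t0 t1] Ht; apply: Ht; rewrite t0 lexx.
have flat_to v : 0 <= v <= 1 -> v < s + del -> S v.
  move=> /andP[v0 v1] vs; split; first lra.
  move=> u /andP[u0 uv]; have [ut|tu] := leP u t.
    by case: St => _ Ht; apply: Ht; rewrite u0.
  by apply/Hd/close; rewrite ltr_norml; lra.
have [s1'|s1'] := leP 1 s.
  have [_ H1] : S 1 by apply: flat_to; lra.
  have := H1 1; rewrite /gam -[ofR 1]/(1 : C) mul1r addrC subrK; apply; lra.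
(* With [s < 1], a parameter beyond the supremum would still belong to [S]. *)
have Sv : S (Num.min 1 (s + del / 2)).
  apply: flat_to; last by rewrite gt_min; apply/orP; right; lra.
  by rewrite ge_min lexx le_min; lra.
have : Num.min 1 (s + del / 2) <= s by apply: ub_le_sup => //; exists 1.
by rewrite ge_min; lra.
Qed.

Lemma mero_ord (D : set C) f a b : segment_closed D ->
  (forall z, D z -> mero f z) -> D a -> D b -> ~ flat f a ->
  exists k, ord f b k.
Proof.
move=> sD mf Da Db nfa; have [fb|//] := meroP (mf b Db).
by case: nfa; exact: (mero_identity sD mf Db Da fb).
Qed.

Lemma mero_eq (D : set C) f g a b : segment_closed D ->
  (forall z, D z -> mero f z) -> (forall z, D z -> mero g z) ->
  D a -> D b -> (\forall z \near a^', f z = g z) -> \forall z \near b^', f z = g z.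
Proof.
move=> sD mf mg Da Db E.
have : flat (fun z => f z - g z) b.
  apply: (mero_identity sD _ Da Db).
    by move=> z Dz; exact: (meroB (mf z Dz) (mg z Dz)).
  by apply: (dnbhsC_S _ E) => z H; rewrite H// subrr.
by apply: dnbhsC_S => z H; apply/eqP; rewrite -subr_eq0 H.
Qed.

(** * Removal of singularities *)

Definition is_limit f a (l : C) := forall e : R, 0 < e ->
  \forall z \near a^', nrm (f z - l) < e.

Lemma is_limit_uniq f a l m : is_limit f a l -> is_limit f a m -> l = m.
Proof.
move=> Hl Hm; apply/eqP; rewrite -subr_eq0; apply/eqP.
apply: (@nrm_small0 _ _ 2) => e e0.
have [z _ [zl zm]] := dnbhs_ex (dnbhs_filterS2 (fun _ => @conj _ _) (Hl e e0) (Hm e e0)).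
by have := nrmBD (f z) l m; rewrite [nrm (l - f z)]nrmB; lra.
Qed.

(* Fills in the removable singularities of f. *)
Definition regularize f (s : C) : C := xget 0 [set l | is_limit f s l].

Lemma regularizeE f a h : {for a, continuous h} ->
  (\forall z \near a^', f z = h z) -> regularize f a = h a.
Proof.
move=> /continuousCP ch E; have L : is_limit f a (h a).
  move=> e e0; have [d d0 Hd] := ch e e0.
  have nd : \forall z \near a^', nrm (z - a) < d by apply/dnbhsCP; exists d.
  by apply: (dnbhs_filterS2 _ E nd) => z -> /Hd.
by apply: (is_limit_uniq _ L); rewrite /regularize; case: xgetP => [l -> //|/(_ (h a))].
Qed.

Lemma regularize_near f a h : holomorphic_at h a ->
  (\forall z \near a^', f z = h z) -> \forall z \near a, regularize f z = h z.
Proof.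
move=> /holomorphic_discP[r r0 dh] /dnbhsCP[d d0 E].
apply/nbhsCP; exists (Num.min r d); first by rewrite lt_min r0.
move=> z; rewrite lt_min => /andP[zr zd]; apply: regularizeE.
  exact: (derivable_continuousC (dh z zr)).
have [->|za] := eqVneq z a; first by apply/dnbhsCP; exists d.
apply/nbhs_dnbhsC/nbhsCP.
exists (Num.min (nrm (z - a)) (d - nrm (z - a))).
  by rewrite lt_min nrm_gt0 !subr_eq0 za subr_gt0.
move=> u; rewrite lt_min => /andP[u1 u2]; apply: E.
  by apply: contraTneq u1 => ->; rewrite nrmB ltxx.
by have := nrmBD z u a; lra.
Qed.

Lemma near_eq_hol f g a : (\forall z \near a, g z = f z) ->
  holomorphic_at f a -> holomorphic_at g a.
Proof.
move=> /nbhsCP[d d0 E] /holomorphic_discP[r r0 df].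
apply/holomorphic_discP; exists (Num.min r d); first by rewrite lt_min r0.
move=> z; rewrite lt_min => /andP[zr zd].
apply: (near_eq_derivableC _ (df z zr)); apply/nbhsCP.
exists (d - nrm (z - a)); first by rewrite subr_gt0.
by move=> u ud; rewrite E//; have := nrmBD z u a; lra.
Qed.

(** Nonnegative order becomes holomorphy once the value at the point is corrected. Around a pole,
    [f] already agrees with a continuous function near each neighbouring point, so the quotient by
    [(z - a) ^+ n] is unaffected there. *)
Lemma regularize_meromorphic (D : set C) f : (forall a, D a -> mero f a) ->
  meromorphic_on D (regularize f).
Proof.
move=> H a /H ma.
have hol_case h : holomorphic_at h a -> (\forall z \near a^', f z = h z) ->
    holomorphic_at (regularize f) a.
  by move=> hh E; apply: (near_eq_hol (regularize_near hh E) hh).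
have [ff|[k [h [hh ha E]]]] := meroP ma.
  by left; apply: (hol_case (fun=> 0)); [exact: hol_cst|exact: ff].
case: k E => [n|n] E.
  by left; apply: (hol_case (fun z => h z * (z - a) ^+ n));
    [exact: (holM hh (hol_subX a n a))|exact: E].
right; exists n.+1; split=> //; exists h; split=> //.
have /holomorphic_discP[r r0 dh] := hh; have /dnbhsCP[d d0 Ed] := E.
apply/dnbhsCP; exists (Num.min r d); first by rewrite lt_min r0.
move=> z za; rewrite lt_min => /andP[zr zd].
have za0 : z - a != 0 by rewrite subr_eq0.
apply: (regularizeE (h := fun z => h z / (z - a) ^+ n.+1)).
  have za0n : (z - a) ^+ n.+1 != 0 by rewrite expf_neq0.
  have dX := derivCX (f := fun z : C => z - a) (n := n.+1)
    (derivCD (derivC_id z) (derivC_cst (- a) z)).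
  exact: (derivable_continuousC (derivCM (dh z zr)
    (derivCV (f := fun z : C => (z - a) ^+ n.+1) za0n dX))).
apply/nbhs_dnbhsC/nbhsCP.
exists (Num.min (nrm (z - a)) (d - nrm (z - a))).
  by rewrite lt_min nrm_gt0 za0 subr_gt0.
move=> u; rewrite lt_min => /andP[u1 u2]; rewrite Ed.
- by rewrite NegzE exprnN.
- by apply: contraTneq u1 => ->; rewrite nrmB ltxx.
- by have := nrmBD z u a; lra.
Qed.

End LocalTheory.

(** * Unconditional products *)

Section NetProducts.
Variables (R : realType) (P : countType).
Local Notation C := (Cplx R).
Local Notation Re := (@complex.Re R).
Local Notation Im := (@complex.Im R).
Implicit Types (x y : {fset P} -> C) (F : P -> C) (b : P -> R).
Local Open Scope fset_scope.
Local Open Scope ring_scope.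

Lemma totallyP (A : set {fset P}) : (\forall J \near totally, A J) <->
  exists J0 : {fset P}, forall J, J0 `<=` J -> A J.
Proof.
split=> [[J0 _ H]|[J0 H]]; first by exists J0 => J; exact: H.
by exists J0.
Qed.

Lemma cvg_totallyP x (L : C) : x @ totally --> L <-> forall e : R, 0 < e ->
  exists J0 : {fset P}, forall J, J0 `<=` J -> nrm (x J - L) < e.
Proof.
split=> [H e e0|H].
  apply/totallyP; exact: ((@cvgCP R _ _ _ _ _).1 H e e0).
by apply/(@cvgCP R _ _ _ _ _) => e /H/totallyP.
Qed.

Lemma lim_totally x (L : C) : x @ totally --> L -> lim (x @ totally) = L.
Proof. by move=> H; exact: (cvg_lim (@norm_hausdorff _ C) H). Qed.

Lemma cvg_totally_cauchy x :
  (forall e : R, 0 < e -> exists J0 : {fset P}, forall J, J0 `<=` J ->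
     nrm (x J - x J0) < e) ->
  exists L : C, x @ totally --> L.
Proof.
move=> H.
have real_lim (u : {fset P} -> R) : (forall e : R, 0 < e ->
    exists J0 : {fset P}, forall J, J0 `<=` J -> `|u J - u J0| < e) ->
    exists l : R, u @ totally --> l.
  move=> Hu; suff : cvg (u @ totally) by move=> cu; exists (lim (u @ totally)).
  apply/cauchy_cvgP/cauchyP => e e0; have [J0 HJ0] := Hu e e0.
  exists (u J0); apply/totallyP; exists J0 => J /HJ0.
  by rewrite /ball /= distrC.
have [|l1 Hl1] := real_lim (Re \o x).
  move=> e /H[J0 HJ0]; exists J0 => J /HJ0; apply: le_lt_trans => /=.
  by rewrite -cReN -cReD le_Re_nrm.
have [|l2 Hl2] := real_lim (Im \o x).
  move=> e /H[J0 HJ0]; exists J0 => J /HJ0; apply: le_lt_trans => /=.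
  by rewrite -cImN -cImD le_Im_nrm.
exists (Complex l1 l2); apply/(@cvgCP R _ _ _ _ _) => e e0.
have e2 : 0 < e / 2 by lra.
move/cvgrPdist_lt : Hl1 => /(_ _ e2) Hl1.
move/cvgrPdist_lt : Hl2 => /(_ _ e2) Hl2.
move: Hl1 Hl2; apply: filterS2 => J /= h1 h2.
apply: le_lt_trans (nrm_le _) _; rewrite cReD cImD cReN cImN /=.
by rewrite distrC [ `|Im _ - _|]distrC; lra.
Qed.

(** Induction from [1 + b <= expR b]. The second bound is small as soon as the sum is. *)
Lemma prod_near1 (s : seq P) F b : (forall p, nrm (F p - 1) <= b p) ->
  nrm (\prod_(p <- s) F p) <= expR (\sum_(p <- s) b p) /\
  nrm (\prod_(p <- s) F p - 1) <= expR (\sum_(p <- s) b p) - 1.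
Proof.
move=> H; elim: s => [|p s [IH1 IH2]].
  by rewrite !big_nil expR0 subrr nrm0 nrm1 subrr.
rewrite !big_cons expRD.
have b0 : 0 <= b p := le_trans (nrm_ge0 _) (H p).
have bE := expR_ge1Dx (b p).
have F1 : nrm (F p) <= 1 + b p.
  by have := nrmD 1 (F p - 1); rewrite addrC subrK nrm1; have := H p; lra.
split.
  rewrite nrmM; apply: ler_pM; rewrite ?nrm_ge0//; lra.
have -> : F p * \prod_(j <- s) F j - 1 =
    (F p - 1) * \prod_(j <- s) F j + (\prod_(j <- s) F j - 1) by ring.
apply: le_trans (nrmD _ _) _; rewrite nrmM.
have h1 : nrm (F p - 1) * nrm (\prod_(j <- s) F j) <=
    b p * expR (\sum_(j <- s) b j) by apply: ler_pM; rewrite ?nrm_ge0.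
have h2 : (1 + b p) * expR (\sum_(j <- s) b j) <=
    expR (b p) * expR (\sum_(j <- s) b j) by rewrite ler_wpM2r// expR_ge0.
by rewrite mulrDl mul1r in h2; lra.
Qed.

Lemma big_fsetD (T : Type) (idx : T) (op : Monoid.com_law idx) (f : P -> T)
    (J K : {fset P}) : J `<=` K ->
  \big[op/idx]_(p <- K) f p =
  op (\big[op/idx]_(p <- J) f p) (\big[op/idx]_(p <- K `\` J) f p).
Proof.
move=> JK; rewrite -big_cat; apply: perm_big; apply: uniq_perm.
- exact: fset_uniq.
- rewrite cat_uniq !fset_uniq /= andbT; apply/hasPn => p.
  by rewrite in_fsetD => /andP[].
- move=> p; rewrite mem_cat in_fsetD.
  by have [/(fsubsetP JK)->|] := boolP (p \in J).
Qed.

Definition summable_bound b :=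
  exists S : R, forall J : {fset P}, \sum_(p <- J) b p <= S.

(** [J0] is a set whose sum is within [e] of the supremum of all finite sums. *)
Lemma small_tail b : (forall p, 0 <= b p) -> summable_bound b ->
  forall e : R, 0 < e -> exists J0 : {fset P}, forall J, J0 `<=` J ->
    \sum_(p <- J `\` J0) b p <= e.
Proof.
move=> b0 [S HS] e e0.
pose E : set R := [set \sum_(p <- J) b p | J in [set: {fset P}]].
have hE : has_sup E.
  by split; [exists (\sum_(p <- (fset0 : {fset P})) b p), fset0|exists S => _ [J _ <-]].
have [_ [J0 _ <-] HJ0] := sup_adherent e0 hE.
exists J0 => J JJ.
have h : \sum_(p <- J) b p =
    \sum_(p <- J0) b p + \sum_(p <- J `\` J0) b p by rewrite (big_fsetD _ _ JJ).
have : \sum_(p <- J) b p <= sup E by apply: ub_le_sup; [case: hE|exists J].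
by rewrite h; lra.
Qed.

(** The bound depends on [F] only through [b], which makes the convergence of Euler products uniform
    in [s]. *)
Lemma eprod_approx F b (S tau : R) (J0 J : {fset P}) :
  (forall p, nrm (F p - 1) <= b p) ->
  (forall J : {fset P}, \sum_(p <- J) b p <= S) ->
  (forall J, J0 `<=` J -> \sum_(p <- J `\` J0) b p <= tau) -> J0 `<=` J ->
  nrm (\prod_(p <- J) F p - \prod_(p <- J0) F p) <= expR S * (expR tau - 1).
Proof.
move=> HF HS Ht JJ; rewrite (big_fsetD (idx := 1 : C) _ F JJ) /=.
set A := \prod_(p <- J0) F p; set B := \prod_(p <- _) F p.
have -> : A * B - A = A * (B - 1) by ring.
have [h1 _] := prod_near1 J0 HF; have [_ h2] := prod_near1 (J `\` J0) HF.
rewrite nrmM; apply: ler_pM; rewrite ?nrm_ge0//.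
  by apply: le_trans h1 _; rewrite ler_expR.
by apply: le_trans h2 _; rewrite lerB// ler_expR Ht.
Qed.

Lemma expR_small (S e : R) : 0 < e ->
  exists2 tau : R, 0 < tau & expR S * (expR tau - 1) <= e.
Proof.
move=> e0; have S0 := expR_gt0 S.
have eS : 0 < e / expR S by rewrite divr_gt0.
exists (ln (1 + e / expR S)); first by rewrite ln_gt0//; lra.
rewrite lnK ?posrE; last lra.
by rewrite addrAC subrr add0r mulrC divfK// gt_eqF.
Qed.

Lemma eprod_cvg F b : (forall p, nrm (F p - 1) <= b p) -> summable_bound b ->
  exists L : C, (fun J : {fset P} => \prod_(p <- J) F p) @ totally --> L.
Proof.
move=> HF sb; have [S HS] := sb.
have b0 p : 0 <= b p := le_trans (nrm_ge0 _) (HF p).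
apply: cvg_totally_cauchy => e e0; have e2 : 0 < e / 2 by lra.
have [tau tau0 Htau] := expR_small S e2.
have [J0 HJ0] := small_tail b0 sb tau0.
exists J0 => J JJ; have := eprod_approx HF HS HJ0 JJ; lra.
Qed.

Lemma cvg_totally_le x (L a : C) (J0 : {fset P}) (M : R) : x @ totally --> L ->
  (forall J, J0 `<=` J -> nrm (x J - a) <= M) -> nrm (L - a) <= M.
Proof.
move=> /cvg_totallyP H HM; apply/ler_addgt0Pr => e /H[J1 HJ1].
have J0U : J0 `<=` J0 `|` J1 by exact: fsubsetUl.
have J1U : J1 `<=` J0 `|` J1 by exact: fsubsetUr.
have := HM _ J0U; have := HJ1 _ J1U.
by have := nrmBD (x (J0 `|` J1)) L a; rewrite [nrm (L - x _)]nrmB; lra.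
Qed.

(** Once the tail of the majorant is at most [ln (3 / 2)], tail products stay within 1/2 of 1, and
    the limit is within [nrm A / 2] of the nonzero partial product [A]. *)
Lemma eprod_neq0 F b (L : C) : (forall p, nrm (F p - 1) <= b p) ->
  summable_bound b -> (forall p, F p != 0) ->
  (fun J : {fset P} => \prod_(p <- J) F p) @ totally --> L -> L != 0.
Proof.
move=> HF sb F0 HL.
have b0 p : 0 <= b p := le_trans (nrm_ge0 _) (HF p).
have t0 : 0 < ln (3 / 2) :> R by rewrite ln_gt0//; lra.
have [J0 HJ0] := small_tail b0 sb t0.
set A := \prod_(p <- J0) F p.
have A0 : A != 0 by rewrite prodf_seq_neq0; apply/allP => p _ /=; exact: F0.
have : nrm (L - A) <= nrm A / 2.
  apply: (cvg_totally_le (J0 := J0) HL) => J JJ.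
  rewrite (big_fsetD (idx := 1 : C) _ F JJ) /= -/A.
  set B := \prod_(p <- _) F p; have -> : A * B - A = A * (B - 1) by ring.
  rewrite nrmM ler_wpM2l ?nrm_ge0//.
  have [_ h2] := prod_near1 (J `\` J0) HF; apply: le_trans h2 _.
  have : expR (\sum_(p <- J `\` J0) b p) <= 3 / 2.
    rewrite -[leRHS]lnK ?posrE; last lra.
    by rewrite ler_expR HJ0.
  lra.
apply: contraTneq => ->; rewrite sub0r nrmN -ltNge.
by have nA : 0 < nrm A; [rewrite nrm_gt0|lra].
Qed.

Lemma cvg_totallyM x y (L M : C) : x @ totally --> L -> y @ totally --> M ->
  (fun J => x J * y J) @ totally --> L * M.
Proof. by move=> Hx Hy; exact: (@cvgM _ _ _ _ x y _ _ Hx Hy). Qed.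

Lemma cvg_totallyV x (L : C) : L != 0 -> x @ totally --> L ->
  (fun J => (x J)^-1) @ totally --> L^-1.
Proof. by move=> L0 Hx; exact: (@cvgV _ _ _ _ x _ L0 Hx). Qed.

Lemma cvg_totally_cst (c : C) : (fun _ : {fset P} => c) @ totally --> c.
Proof. exact: cvg_cst. Qed.

Lemma cvg_totally_prod (I : Type) (s : seq I) (X : I -> {fset P} -> C)
    (L : I -> C) : (forall i, X i @ totally --> L i) ->
  (fun J => \prod_(i <- s) X i J) @ totally --> \prod_(i <- s) L i.
Proof.
move=> H; elim: s => [|i s IH].
  rewrite big_nil; have -> : (fun J => \prod_(i <- [::]) X i J) = (fun=> 1).
    by apply/funext => J; rewrite big_nil.
  exact: cvg_totally_cst.
rewrite big_cons; have -> : (fun J => \prod_(j <- i :: s) X j J) =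
    (fun J => X i J * \prod_(j <- s) X j J).
  by apply/funext => J; rewrite big_cons.
exact: (cvg_totallyM (H i) IH).
Qed.

Lemma cvg_totally_eq x y (L M : C) : x @ totally --> L -> y @ totally --> M ->
  x =1 y -> L = M.
Proof.
move=> Hx Hy /funext E; rewrite -(lim_totally Hx) -(lim_totally Hy).
by rewrite E.
Qed.

End NetProducts.

(** * Euler products *)

Section EulerFactors.
Variables (R : realType) (P : countType) (N : P -> R).
Local Notation C := (Cplx R).
Local Notation Re := (@complex.Re R).
Implicit Types (c : P -> C) (s : C).

Lemma expC_mulrn (n : nat) (z : C) : expC (n%:R * z) = expC z ^+ n.
Proof.
elim: n => [|n IH]; first by rewrite mul0r expC0.
by rewrite -natr1 mulrDl mul1r expCD IH exprSr.
Qed.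

Lemma cpow_natM (x : R) (n : nat) s : cpow x (- (n%:R * s)) = cpow x (- s) ^+ n.
Proof. by rewrite /cpow -expC_mulrn; congr expC; rewrite -mulrN -mulrA. Qed.

Lemma nrm_cpow (x : R) s : 0 < x -> nrm (cpow x s) = x `^ (Re s).
Proof.
by move=> x0; rewrite nrm_expC cReM /= mulr0 subr0 /powR gt_eqF.
Qed.

Lemma derivable_cpowN (x : R) s : derivable (fun u : C => cpow x (- u)) s 1.
Proof.
exact: (derivC_comp (f := fun u : C => - u * ofR (ln x))
  (derivCM (derivCN (derivC_id s)) (derivC_cst (ofR (ln x)) s)) (@derivable_expC R _)).
Qed.

(** The coefficient [c] covers both kinds of product: an indicator function leads to [zetaP], the
    values of a character to [LP]. *)
Definition efac c s (p : P) : C := 1 - c p * cpow (N p) (- s).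

(** The reciprocal of the zeta or L-function: the factors enter uninverted, and [N p] to the power
    [- Re s] bounds their distance to 1. *)
Definition EL c s : C :=
  lim ((fun J : {fset P} => \prod_(p <- J) efac c s p) @ totally).

Hypothesis N_gt1 : forall p, 1 < N p.

Lemma nrm_efac c s p (sigma : R) : nrm (c p) <= 1 -> sigma <= Re s ->
  nrm (efac c s p - 1) <= N p `^ (- sigma).
Proof.
move=> c1 ss; rewrite /efac addrAC subrr add0r nrmN nrmM.
rewrite nrm_cpow; last exact: lt_trans (N_gt1 p).
rewrite -[leRHS]mul1r; apply: ler_pM; rewrite ?nrm_ge0 ?powR_ge0//.
by rewrite cReN ler_powR ?lerN2// ltW.
Qed.

Lemma efac_neq0 c s p : nrm (c p) <= 1 -> 0 < Re s -> efac c s p != 0.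
Proof.
move=> c1 s0; rewrite subr_eq0 eq_sym; apply/eqP => /(congr1 (@nrm R)).
rewrite nrm1 nrmM nrm_cpow; last exact: lt_trans (N_gt1 p).
rewrite cReN => /eqP; rewrite lt_eqF//.
have N0 : 0 < N p := lt_trans ltr01 (N_gt1 p).
have : N p `^ (- Re s) < 1.
  rewrite /powR gt_eqF// -expR0 ltr_expR mulNr oppr_lt0 mulr_gt0// ln_gt0//.
move=> h; apply: le_lt_trans h; rewrite -[leRHS]mul1r.
by rewrite ler_wpM2r ?powR_ge0.
Qed.

Hypothesis N_summable : forall sigma : R, 1 < sigma ->
  summable_bound (fun p => N p `^ (- sigma)).

Lemma EL_cvg c s : (forall p, nrm (c p) <= 1) -> 1 < Re s ->
  (fun J : {fset P} => \prod_(p <- J) efac c s p) @ totally --> EL c s.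
Proof.
move=> c1 s1.
have [L HL] := eprod_cvg (fun p => nrm_efac (c1 p) (lexx (Re s))) (N_summable s1).
by rewrite /EL (lim_totally HL).
Qed.

Lemma EL_neq0 c s : (forall p, nrm (c p) <= 1) -> 1 < Re s -> EL c s != 0.
Proof.
move=> c1 s1.
apply: (eprod_neq0 (fun p => nrm_efac (c1 p) (lexx (Re s))) (N_summable s1) _
  (EL_cvg c1 s1)).
by move=> p; apply: efac_neq0 => //; lra.
Qed.

Lemma derivable_eprod c (J : {fset P}) s :
  derivable (fun u : C => \prod_(p <- J) efac c u p) s 1.
Proof.
elim: (enum_fset J) => [|p r IH].
  have -> : (fun u : C => \prod_(p <- [::]) efac c u p) = (fun=> 1).
    by apply/funext => u; rewrite big_nil.
  exact: derivC_cst.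
have -> : (fun u : C => \prod_(j <- p :: r) efac c u j) =
    (fun u : C => efac c u p * \prod_(j <- r) efac c u j).
  by apply/funext => u; rewrite big_cons.
apply: (derivCM _ IH).
exact: (derivCD (derivC_cst 1 s) (derivCN
  (derivCM (derivC_cst (c p) s) (@derivable_cpowN (N p) s)))).
Qed.

Lemma EL_hol c s : (forall p, nrm (c p) <= 1) -> 1 < Re s ->
  holomorphic_at (EL c) s.
Proof.
move=> c1 s1.
have der a : 1 < Re a -> derivable (EL c) a 1.
  (* With this radius [1 + r <= Re z] on the whole disc, so one summable majorant serves all its
     points and the partial products converge uniformly. *)
  move=> a1; pose r := (Re a - 1) / 2.
  have r0 : 0 < r by rewrite /r; lra.
  have rs1 : 1 < 1 + r by lra.
  have Rez z : nrm (z - a) < r -> 1 + r <= Re z.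
    move=> zr; have := le_lt_trans (le_Re_nrm _) zr; rewrite cReD cReN.
    by rewrite ltr_norml /r; lra.
  have sb := N_summable rs1; have [S HS] := sb.
  have b0 p : 0 <= N p `^ (- (1 + r)) by exact: powR_ge0.
  apply: (uniform_limit_derivable r0) => e e0.
  have [tau tau0 Htau] := expR_small S e0.
  have [J0 HJ0] := small_tail b0 sb tau0.
  exists (fun u : C => \prod_(p <- J0) efac c u p) => z zr.
    exact: derivable_eprod.
  have z1 : 1 < Re z by have := Rez z zr; lra.
  apply: le_trans _ Htau; apply: (cvg_totally_le (J0 := J0) (EL_cvg c1 z1)).
  move=> J JJ; apply: (eprod_approx _ HS HJ0 JJ) => p.
  exact: (nrm_efac (c1 p) (Rez z zr)).
apply/nbhsCP; exists (Re s - 1); first by lra.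
move=> z zs; apply: der; have := le_lt_trans (le_Re_nrm _) zs.
by rewrite cReD cReN ltr_norml; lra.
Qed.

(** As a coefficient it turns the factors outside [A] into 1, so a product over [A] becomes a
    product over [P]. *)
Definition setchar (A : set P) (p : P) : C := (p \in A)%:R.

Lemma nrm_setchar A p : nrm (setchar A p) <= 1.
Proof. by rewrite /setchar; case: (p \in A); rewrite ?nrm1 ?nrm0. Qed.

Lemma zetaPE A s : 1 < Re s -> zetaP N A s = (EL (setchar A) s)^-1.
Proof.
move=> s1; rewrite /zetaP /uprod.
apply: lim_totally.
have -> : (fun J : {fset P} => \prod_(p <- J | p \in A) (1 - cpow (N p) (- s))^-1) =
    (fun J : {fset P} => (\prod_(p <- J) efac (setchar A) s p)^-1).
  apply/funext => J; rewrite big_mkcond -prodfV; apply: eq_bigr => p _.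
  by rewrite /efac /setchar; case: (p \in A); rewrite ?mul1r// mul0r subr0 invr1.
apply: cvg_totallyV; last exact: (EL_cvg (@nrm_setchar A) s1).
exact: (EL_neq0 (@nrm_setchar A) s1).
Qed.

Lemma zetaP_hol A s : 1 < Re s -> holomorphic_at (zetaP N A) s.
Proof.
move=> s1; have n0 := EL_neq0 (@nrm_setchar A) s1.
have h := holV (EL_hol (@nrm_setchar A) s1) n0.
apply: (near_eq_hol _ h); apply/nbhsCP; exists (Re s - 1); first by lra.
move=> z zs; apply: zetaPE; have := le_lt_trans (le_Re_nrm _) zs.
by rewrite cReD cReN ltr_norml; lra.
Qed.

Lemma zetaP_neq0 A s : 1 < Re s -> zetaP N A s != 0.
Proof. by move=> s1; rewrite zetaPE// invr_eq0 (EL_neq0 (@nrm_setchar A) s1). Qed.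

Lemma uprodT_EL c s F : (forall p, nrm (c p) <= 1) -> 1 < Re s ->
  (forall p, F p = (efac c s p)^-1) -> uprod [set: P] F = (EL c s)^-1.
Proof.
move=> c1 s1 HF; rewrite /uprod; apply: lim_totally.
have -> : (fun J : {fset P} => \prod_(p <- J | p \in [set: P]) F p) =
    (fun J : {fset P} => (\prod_(p <- J) efac c s p)^-1).
  apply/funext => J; rewrite -prodfV; apply: eq_big => [p|p _]; last exact: HF.
  by rewrite in_setT.
apply: cvg_totallyV; last exact: (EL_cvg c1 s1).
exact: (EL_neq0 c1 s1).
Qed.

End EulerFactors.
Arguments setchar R {P} A p.

(** * Summability to the right of the abscissa *)

Section Abscissa.
Variables (R : realType) (P : countType) (N : P -> R).

(** The set of admissible exponents is nonempty and bounded below, so its infimum 1 is approached by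
    some admissible [d < sigma], and [N p > 1] compares the two powers. *)
Lemma abscissa_summable : (forall p, 1 < N p) ->
  (exists d : R, 0 < d /\ (\esum_(p in [set: P]) (N p `^ (- d))%:E < +oo)%E) ->
  inf [set d : R | 0 < d /\
    (\esum_(p in [set: P]) (N p `^ (- d))%:E < +oo)%E] = 1 ->
  forall sigma : R, 1 < sigma -> summable_bound (fun p => N p `^ (- sigma)).
Proof.
move=> N1 [d0 Hd0]; set E := [set d | _] => infE sigma s1.
have hE : has_inf E by split; [exists d0|exists 0 => d [/ltW]].
have s10 : 0 < sigma - 1 by lra.
have [d [dp dsum] ds] := inf_adherent s10 hE.
rewrite infE addrC subrK in ds.
exists (fine (\esum_(p in [set: P]) (N p `^ (- d))%:E)) => J.
have e0 : (0 <= \esum_(p in [set: P]) (N p `^ (- d))%:E)%E.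
  by apply: esum_ge0 => p _; rewrite lee_fin powR_ge0.
apply: (@le_trans _ _ (\sum_(p <- J) N p `^ (- d))).
  by apply: ler_sum => p _; rewrite ler_powR ?lerN2 ?ltW.
rewrite -lee_fin fineK; last by rewrite ge0_fin_numE.
rewrite -sumEFin; apply: esum_ge; exists [set` J].
  by split; [exact: finite_fset|].
rewrite fsbig_finite; last exact: finite_fset.
by rewrite set_fsetK.
Qed.

End Abscissa.

(** * Characters of a cyclic group *)

Section CyclicCharacters.
Variables (R : realType) (gT : finGroupType) (G : {group gT}).
Local Notation C := (Cplx R).

(** The degree is 1 only by a propositional equation, so a representation of degree one is handled
    through its trace, which lies in [C] whatever [n] is. *)
Lemma repr_trM n (rG : mx_representation C G n) : n = 1%N ->
  {in G &, forall g h, \tr (rG (g * h)%g) = \tr (rG g) * \tr (rG h)}.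
Proof.
move=> n1; subst n => g h gG hG; rewrite repr_mxM//.
rewrite [rG g]mx11_scalar [rG h]mx11_scalar -scalar_mxM.
by rewrite !mxtrace_scalar !mulr1n.
Qed.

Lemma repr_trX n (rG : mx_representation C G n) g k : n = 1%N -> g \in G ->
  \tr (rG (g ^+ k)%g) = \tr (rG g) ^+ k.
Proof.
move=> n1 gG; subst n; elim: k => [|k IH].
  by rewrite expg0 repr_mx1 mxtrace_scalar mulr1n.
by rewrite expgS repr_trM ?groupX// IH exprS.
Qed.

Lemma det_repr1 n (rG : mx_representation C G n) (X : C) g : n = 1%N ->
  \det (1%:M - X *: rG g) = 1 - \tr (rG g) * X.
Proof.
move=> n1; subst n; rewrite det_mx11 [rG g]mx11_scalar mxtrace_scalar !mxE.
by rewrite eqxx /= mulr1n mulrC.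
Qed.

Lemma rsim_linear n m (rG : mx_representation C G n)
    (rH : mx_representation C G m) : n = 1%N -> m = 1%N ->
  {in G, forall g, \tr (rG g) = \tr (rH g)} -> mx_rsim rG rH.
Proof.
move=> n1 m1; subst n m => H; exists (1%:M) => //; first by rewrite row_free_unit unitmx1.
move=> g gG; rewrite mulmx1 mul1mx [rG g]mx11_scalar [rH g]mx11_scalar.
by have := H g gG; rewrite {1}[rG g]mx11_scalar {1}[rH g]mx11_scalar !mxtrace_scalar !mulr1n
  => ->.
Qed.

(** The discrete logarithm to base [x]; the default 0 concerns only elements outside the group
    generated by [x]. *)
Definition dlog (x g : gT) : nat := odflt 0%N
  (omap (@nat_of_ord _) [pick k : 'I_(#[x]%g) | g == (x ^+ k)%g]).

Lemma dlogP x g : g \in <[x]>%g -> g = (x ^+ dlog x g)%g.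
Proof.
move=> /cyclePmin[k kx gE]; rewrite /dlog; case: pickP => [j /eqP//|].
by move=> /(_ (Ordinal kx)) /=; rewrite -gE eqxx.
Qed.

(** [x ^+ k] acts by [w ^+ k], which is well defined because [w] is killed by the order of [x]; a
    root of unity has modulus 1, whence unitarity. *)
Lemma unity_repr (x : gT) (w : C) : G = <[x]>%G -> w ^+ #[x]%g = 1 ->
  exists rG : mx_representation C G 1, unitary_repr rG /\ rG x = w%:M.
Proof.
move=> Gx wq.
have wmod k j : (x ^+ k)%g = (x ^+ j)%g -> w ^+ k = w ^+ j.
  move=> /eqP; rewrite eq_expg_mod_order => /eqP kj.
  by rewrite -(expr_mod k wq) kj expr_mod.
have inG g : g \in G -> g \in <[x]>%g by rewrite Gx.
have rP : mx_repr G (fun g => (w ^+ dlog x g)%:M : 'M[C]_1).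
  split.
    congr (_%:M); rewrite -(expr0 w); apply: wmod.
    by rewrite -dlogP ?group1// expg0.
  move=> g h gG hG /=; rewrite -scalar_mxM -exprD; congr (_%:M); apply: wmod.
  by rewrite expgD -!dlogP// inG// groupM.
exists (MxRepresentation rP); split; last first.
  rewrite /=; congr (_%:M); rewrite -[RHS]expr1; apply: wmod.
  by rewrite -dlogP ?cycle_id// expg1.
move=> g gG /=; apply/unitarymxP.
have w1 : `|w| = 1.
  apply/eqP; rewrite -(@pexpr_eq1 _ _ #[x]%g) ?order_gt0 ?normr_ge0//.
  by rewrite -normrX wq normr1.
rewrite [X in _ *m X](_ : _ = ((w ^+ dlog x g)^*)%:M); last first.
  by apply/matrixP => i j; rewrite !mxE !ord1 eqxx !mulr1n.
by rewrite -scalar_mxM -normCK normrX w1 !expr1n.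
Qed.

Variable Ghat : unitary_dual R G.
Hypothesis G_cyclic : cyclic G.

(** [C] is algebraically closed, so irreducible means absolutely irreducible, which for an abelian
    group means degree 1. *)
Lemma udim1 (i : Ghat) : udim i = 1%N.
Proof.
have cG := cyclic_abelian G_cyclic.
have := urepr_irr i => /(@group_closure_closed_field C gT G _ _).
by rewrite abelian_abs_irr// => /eqP.
Qed.

Definition uchar (i : Ghat) (g : gT) : C := \tr (urepr i g).

Lemma uchar_cycle_inj x : G = <[x]>%G -> injective (uchar^~ x).
Proof.
move=> Gx i j ij; apply: (@urepr_inj _ _ _ Ghat).
apply: rsim_linear; rewrite ?udim1// => g gG.
have : g \in <[x]>%g by rewrite -[<[x]>%g]/(gval <[x]>%G) -Gx.
have xG : x \in G by rewrite Gx /= cycle_id.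
by move=> /cycleP[k ->]; rewrite !repr_trX ?udim1//; congr (_ ^+ _).
Qed.

Lemma uchar_order x i : x \in G -> uchar i x ^+ #[x]%g = 1.
Proof.
move=> xG; rewrite /uchar -repr_trX ?udim1// expg_order.
by rewrite repr_mx1 mxtrace_scalar udim1 mulr1n.
Qed.

Lemma uchar1 i : uchar i 1%g = 1.
Proof. by rewrite /uchar repr_mx1 mxtrace_scalar udim1 mulr1n. Qed.

Lemma nrm_uchar i g : g \in G -> nrm (uchar i g) = 1.
Proof.
move=> gG; have := congr1 (@nrm R) (uchar_order i gG); rewrite nrmX nrm1.
by move/eqP; rewrite pexpr_eq1 ?order_gt0 ?nrm_ge0// => /eqP.
Qed.

Lemma uchar_surj x (w : C) : G = <[x]>%G -> w ^+ #[x]%g = 1 ->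
  exists i, uchar i x = w.
Proof.
move=> Gx wq; have [rG [urG rGx]] := unity_repr Gx wq.
have cG := cyclic_abelian G_cyclic.
have irr : mx_irreducible rG by apply: mx_abs_irrW; rewrite abelian_abs_irr.
have [i sim] := urepr_complete Ghat urG irr; exists i.
have xG : x \in G by rewrite Gx /= cycle_id.
by rewrite /uchar -(mxtrace_rsim sim)// rGx mxtrace_scalar mulr1n.
Qed.

Lemma unity_roots n : (0 < n)%N -> exists rs : seq C,
  [/\ uniq rs, size rs = n, forall w, (w \in rs) = (w ^+ n == 1) &
      forall Y : C, \prod_(r <- rs) (Y - r) = Y ^+ n - 1].
Proof.
move=> n0; have [rs E] := closed_field_poly_normal ('X^n - 1 : {poly C}).
have lc : lead_coef ('X^n - 1 : {poly C}) = 1.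
  by apply/eqP; rewrite -[_ == _]/('X^n - 1 \is monic) monicXnsubC.
rewrite lc scale1r in E.
have hE Y : \prod_(r <- rs) (Y - r) = Y ^+ n - 1.
  have := congr1 (fun p => p.[Y]) E; rewrite !hornerE horner_prod => ->.
  by apply: eq_bigr => r _; rewrite !hornerE.
exists rs; split=> //.
- rewrite -separable_prod_XsubC -E; apply: separable_Xn_sub_1.
  by rewrite pnatr_eq0 -lt0n.
- have := congr1 (fun p : {poly C} => size p) E.
  by rewrite size_XnsubC// size_prod_XsubC => -[].
- by move=> w; rewrite -root_prod_XsubC -E rootE !hornerE subr_eq0.
Qed.

(** At a generator the characters take each root of unity exactly once: injectivity is the
    irredundancy of the dual, surjectivity its completeness. *)
Lemma uchar_roots x : G = <[x]>%G -> exists rs : seq C,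
  [/\ size rs = #|G|, forall Y : C, \prod_(r <- rs) (Y - r) = Y ^+ #|G| - 1 &
      perm_eq [seq uchar i x | i <- enum Ghat] rs].
Proof.
move=> Gx; have oG : #[x]%g = #|G| by rewrite Gx.
have [rs [urs srs mrs prs]] := unity_roots (cardG_gt0 G).
exists rs; split=> //; apply: uniq_perm => //.
  by rewrite map_inj_uniq ?enum_uniq//; exact: uchar_cycle_inj.
have xG : x \in G by rewrite Gx /= cycle_id.
move=> w; rewrite mrs; apply/mapP/eqP => [[i _ ->]|wq].
  by rewrite -oG uchar_order.
rewrite -oG in wq; have [i iw] := uchar_surj Gx wq.
by exists i; rewrite ?mem_enum.
Qed.

Lemma card_udual : #|Ghat| = #|G|.
Proof.
have /cyclicP[x Gx] := G_cyclic.
have Gx' : G = <[x]>%G by apply/val_inj.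
have [rs [srs _ /perm_size]] := uchar_roots Gx'.
by rewrite size_map srs -cardE.
Qed.

(** The factorization of [Y ^+ #|G| - 1] at [Y = X^-1], multiplied by [X ^+ #|G|]; hence the
    separate case [X = 0]. *)
Lemma prod_uchar x (X : C) : G = <[x]>%G ->
  \prod_(i : Ghat) (1 - uchar i x * X) = 1 - X ^+ #|G|.
Proof.
move=> Gx; have [rs [srs prs pe]] := uchar_roots Gx.
have -> : \prod_(i : Ghat) (1 - uchar i x * X) = \prod_(r <- rs) (1 - r * X).
  by rewrite -(perm_big _ pe) big_map big_enum.
have [->|X0] := eqVneq X 0.
  rewrite expr0n gtn_eqF ?cardG_gt0// subr0 big1// => r _.
  by rewrite mulr0 subr0.
have -> : \prod_(r <- rs) (1 - r * X) = \prod_(r <- rs) (X * (X^-1 - r)).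
  by apply: eq_bigr => r _; rewrite mulrBr divff// mulrC.
rewrite big_split /= prs big_const_seq count_predT srs iter_mulr mulr1.
by rewrite mulrBr mulr1 -exprMn divff// expr1n.
Qed.

Lemma trivial_repr_uchar i : trivial_repr (urepr i) ->
  {in G, forall g, uchar i g = 1}.
Proof.
by move=> [_ H] g gG; rewrite /uchar H// mxtrace_scalar udim1 mulr1n.
Qed.

(** The trivial character is the one with value 1 at a generator, which also makes it unique in the
    dual. *)
Lemma ex_trivial : exists i0 : Ghat, [/\ trivial_repr (urepr i0),
  {in G, forall g, uchar i0 g = 1} &
  forall i, i != i0 -> ~ trivial_repr (urepr i)].
Proof.
have /cyclicP[x Gx] := G_cyclic.
have Gx' : G = <[x]>%G by apply/val_inj.
have xG : x \in G by rewrite Gx' /= cycle_id.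
have [i0 i0x] := uchar_surj Gx' (expr1n C #[x]%g).
have i01 : {in G, forall g, uchar i0 g = 1}.
  move=> g; rewrite {1}Gx => /cycleP[k ->].
  by rewrite /uchar repr_trX ?udim1// -/(uchar i0 x) i0x expr1n.
exists i0; split=> //.
  split; first exact: udim1.
  move=> g gG; have := i01 g gG; rewrite /uchar.
  move: (urepr i0 g); rewrite udim1 => A; rewrite [A]mx11_scalar mxtrace_scalar.
  by rewrite mulr1n => ->.
move=> i /eqP ii triv; apply: ii; apply: (uchar_cycle_inj Gx').
by rewrite /= i0x (trivial_repr_uchar triv).
Qed.

End CyclicCharacters.

(** * The continuation of zeta_q *)

Section MainArgument.
Variables (R : realType) (P : countType) (N : P -> R).
Local Notation C := (Cplx R).
Local Notation Re := (@complex.Re R).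
Hypothesis N_gt1 : forall p, 1 < N p.
Hypothesis N_summable : forall sigma : R, 1 < sigma ->
  summable_bound (fun p => N p `^ (- sigma)).
Variables (q : nat) (gT : finGroupType) (G : {group gT}).
Hypothesis q_prime : prime q.
Hypothesis G_cyclic : cyclic G.
Hypothesis G_card : #|G| = q.
Variables (Ghat : unitary_dual R G) (phi : P -> Conj G).

Local Notation frob := (fun p => repr (val (phi p))).
Local Notation zq := (zetaP N (Pord phi q)).

(** * The identity between Euler products *)

Lemma frob_in p : frob p \in G.
Proof.
have /imsetP[x xG xE] := valP (phi p).
have : repr (val (phi p)) \in (x ^: G)%g by rewrite xE (mem_repr x)// class_refl.
by have /fintype.subsetP sub : (x ^: G)%g \subset G; [rewrite class_subG|exact: sub].
Qed.

Lemma frob_order p : #[frob p]%g = 1%N \/ #[frob p]%g = q.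
Proof.
have := order_dvdG (frob_in p); rewrite G_card => /(primeP q_prime).2.
by case/orP => /eqP; [left|right].
Qed.

Lemma Re_natM n (s : C) : Re (n%:R * s) = n%:R * Re s.
Proof. by rewrite -ofR_nat cReM /= mul0r subr0. Qed.

Lemma q_gt0R : 0 < q%:R :> R.
Proof. by rewrite ltr0n prime_gt0. Qed.

Lemma q_ge1R : 1 <= q%:R :> R.
Proof. by rewrite ler1n prime_gt0. Qed.

Lemma Re_qM s : 1 < Re s -> 1 < Re (q%:R * s).
Proof.
move=> s1; rewrite Re_natM; apply: (lt_le_trans s1).
by apply: ler_peMl; [exact: (le_trans ler01 (ltW s1))|exact: q_ge1R].
Qed.

Lemma nrm_uchar_frob (i : Ghat) p : nrm (uchar i (frob p)) <= 1.
Proof. by rewrite nrm_uchar// frob_in. Qed.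

Lemma expr_udim (x : C) (i : Ghat) : x ^+ udim i = x.
Proof. by rewrite udim1. Qed.

Lemma LPE (i : Ghat) s : 1 < Re s ->
  LP N phi (urepr i) s = (EL N (fun p => uchar i (frob p)) s)^-1.
Proof.
move=> s1; apply: uprodT_EL => // [p|p]; first exact: nrm_uchar_frob.
by rewrite det_repr1 ?udim1.
Qed.

(** As [q] is prime, the orders 1 and [q] partition [P]. *)
Lemma setchar_ord p : (setchar R (Pord phi 1) p = 1 /\ setchar R (Pord phi q) p = 0 /\
    #[frob p]%g = 1%N) \/
  (setchar R (Pord phi 1) p = 0 /\ setchar R (Pord phi q) p = 1 /\ #[frob p]%g = q).
Proof.
have q1 : q <> 1%N by move=> E; move: q_prime; rewrite E.
have memP m : p \in Pord phi m = (#[frob p]%g == m).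
  by apply/idP/eqP; rewrite inE.
rewrite /setchar !memP; have [->|->] := frob_order p; [left|right].
  by rewrite eqxx (introF eqP (nesym q1)).
by rewrite eqxx (introF eqP q1).
Qed.

Lemma EL_split s : 1 < Re s -> EL N (setchar R [set: P]) s =
  EL N (setchar R (Pord phi 1)) s * EL N (setchar R (Pord phi q)) s.
Proof.
move=> s1; have c A := EL_cvg N_gt1 N_summable (@nrm_setchar R P A) s1.
apply: (cvg_totally_eq (c setT) (cvg_totallyM (c _) (c _))) => J.
rewrite -big_split /=; apply: eq_bigr => p _; rewrite /efac.
rewrite {1}/setchar in_setT /=.
by have [[-> [-> _]]|[-> [-> _]]] := setchar_ord p; ring.
Qed.

Lemma EL_chars s : 1 < Re s ->
  \prod_(i : Ghat) EL N (fun p => uchar i (frob p)) s =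
  EL N (setchar R (Pord phi 1)) s ^+ q * EL N (setchar R (Pord phi q)) (q%:R * s).
Proof.
move=> s1; have c A u (u1 : 1 < Re u) := EL_cvg N_gt1 N_summable (@nrm_setchar R P A) u1.
(* The [q]-th power of a limit, as a product of [q] equal limits. *)
have cX n : (fun J : {fset P} => \prod_(k <- iota 0 n)
    \prod_(p <- J) efac N (setchar R (Pord phi 1)) s p) @ totally -->
    \prod_(k <- iota 0 n) EL N (setchar R (Pord phi 1)) s.
  by apply: cvg_totally_prod => k; exact: c.
have cL (i : Ghat) := EL_cvg N_gt1 N_summable (nrm_uchar_frob i) s1.
have := cvg_totally_eq (cvg_totally_prod (s := index_enum Ghat) cL)
  (cvg_totallyM (cX q) (c (Pord phi q) _ (Re_qM s1))).
rewrite big_const_seq count_predT size_iota iter_mulr mulr1; apply => J.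
rewrite big_const_seq count_predT size_iota iter_mulr mulr1.
rewrite exchange_big /= -prodrXl -big_split /=; apply: eq_bigr => p _.
rewrite /efac cpow_natM; set X := cpow _ _.
have [[-> [-> o1]]|[-> [-> oq]]] := setchar_ord p.
  (* For the trivial class all characters are 1 and the product is [(1 - X) ^+ q]. *)
  have -> : frob p = 1%g by apply/eqP; rewrite -order_eq1 o1.
  under eq_bigr do rewrite uchar1//.
  by rewrite prodr_const card_udual// G_card !mul1r mul0r subr0 mulr1.
(* An element of order [q] generates [G], so the product is [1 - X ^+ q], which is the factor at
   [q%:R * s]. *)
have Gx : G = <[frob p]>%G.
  apply/val_inj/esym/eqP => /=; rewrite eqEcard cycle_subG frob_in.
  by rewrite G_card -[#|_|]/(#[frob p]%g) oq leqnn.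
by rewrite mul0r subr0 expr1n !mul1r (prod_uchar Ghat G_cyclic _ Gx) G_card.
Qed.

Lemma ZPE s : 1 < Re s -> ZP N phi Ghat s =
  (EL N (setchar R (Pord phi 1)) s ^+ q * EL N (setchar R (Pord phi q)) (q%:R * s))^-1.
Proof.
move=> s1; rewrite -EL_chars// -prodfV; apply: eq_bigr => i _.
by rewrite expr_udim LPE.
Qed.

(** With [zeta_1] the product over classes of order 1, [zeta_P = zeta_1 zeta_q] and
    [Z_P(s) = zeta_1(s)^q zeta_q(q s)]; the power of [zeta_1] cancels. *)
Lemma euler_identity s : 1 < Re s ->
  zq s ^+ q / zq (q%:R * s) = zetaP N [set: P] s ^+ q / ZP N phi Ghat s.
Proof.
move=> s1; have qs1 := Re_qM s1.
have n0 A u (u1 : 1 < Re u) := EL_neq0 N_gt1 N_summable (@nrm_setchar R P A) u1.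
rewrite !zetaPE// ZPE// EL_split//.
have key (A B c : C) : A != 0 -> B != 0 -> B^-1 * c = (A * B)^-1 * (A * c).
  by move=> A0 B0; field; rewrite ?A0 ?B0.
rewrite !invrK !exprVn exprMn; apply: key; rewrite expf_neq0//; exact: n0.
Qed.

(** * The continued quotient F and its orders *)

Variables (zc : C -> C) (Lc : Ghat -> C -> C) (i0 : Ghat).
Hypothesis zc_cont :
  meromorphic_continuation (re_gt 1) [set: C] (zetaP N [set: P]) zc.
Hypothesis zc_pole : simple_pole zc 1.
Hypothesis i0_triv : {in G, forall g, uchar i0 g = 1}.
Hypothesis Lc_cont : forall i, i != i0 ->
  [/\ meromorphic_continuation (re_gt 1) [set: C] (LP N phi (urepr i)) (Lc i),
      holomorphic_on (re_ge 1) (Lc i) & nonvanishing_on (re_ge 1) (Lc i)].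

(** The continuation of [zeta_P ^ q / Z_P], one factor [zeta_P] being cancelled against that of the
    trivial character; hence [q.-1]. *)
Definition quotF (s : C) : C := zc s ^+ q.-1 / \prod_(i | i != i0) Lc i s.

Lemma LP_triv s : 1 < Re s -> LP N phi (urepr i0) s = zetaP N [set: P] s.
Proof.
move=> s1; rewrite LPE// zetaPE//; congr (_^-1).
congr (EL N _ s); apply/funext => p.
by rewrite i0_triv ?frob_in// /setchar in_setT.
Qed.

Lemma quotFE s : 1 < Re s -> zq s ^+ q = quotF s * zq (q%:R * s).
Proof.
move=> s1; have qs0 := zetaP_neq0 N_gt1 N_summable (Pord phi q) (Re_qM s1).
have := euler_identity s1; move=> /(congr1 (fun x => x * zq (q%:R * s))).
rewrite divfK// => ->; congr (_ * _).
have z0 := zetaP_neq0 N_gt1 N_summable [set: P] s1.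
have [_ _ zcE] := zc_cont.
rewrite /quotF /ZP zcE// (bigD1 i0)//= expr_udim LP_triv//.
have -> : \prod_(i | i != i0) LP N phi (urepr i) s ^+ udim i =
    \prod_(i | i != i0) Lc i s.
  apply: eq_bigr => i /Lc_cont[[_ _ LE] _ _].
  by rewrite expr_udim LE.
have -> : zetaP N [set: P] s ^+ q = zetaP N [set: P] s * zetaP N [set: P] s ^+ q.-1.
  by rewrite -exprS prednK// prime_gt0.
by rewrite invfM mulrACA divff// mul1r.
Qed.

Lemma quotF_mero a : mero quotF a.
Proof.
have [_ mz _] := zc_cont.
apply: (meroM (meroX q.-1 (meromorphic_mero mz I))).
apply: (meroV (f := fun s => \prod_(i | i != i0) Lc i s)).
by apply: mero_prod => i /Lc_cont[[_ mL _] _ _]; exact: (meromorphic_mero mL I).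
Qed.

Lemma segment_closed_re_gt (x : R) : segment_closed (re_gt x).
Proof.
move=> a b t /= ax bx /andP[t0 t1]; rewrite /re_gt /=.
rewrite cReD cReM /= mul0r subr0 cReD cReN.
have [tb|tb] := leP t 0.
  by have -> : t = 0; [lra|rewrite mul0r addr0].
have h : 0 < t * (Re b - x) by rewrite mulr_gt0// subr_gt0.
have h2 : 0 <= (1 - t) * (Re a - x) by rewrite mulr_ge0// subr_ge0// ltW.
rewrite -subr_gt0.
have -> : Re a + t * (Re b - Re a) - x = t * (Re b - x) + (1 - t) * (Re a - x) by ring.
lra.
Qed.

Lemma near_re_gt (x : R) (a : C) : x < Re a -> \forall z \near a, x < Re z.
Proof.
move=> xa; apply/nbhsCP; exists (Re a - x); first by lra.
move=> z zs; have := le_lt_trans (le_Re_nrm _) zs.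
by rewrite cReD cReN ltr_norml; lra.
Qed.

Lemma two_gt1 : 1 < Re (ofR 2).
Proof. by rewrite /=; lra. Qed.

(** Where Re s > 1, a zero of [quotF] would be a zero of [zq]. So [quotF] is not flat at 2, and by
    the identity principle it is flat nowhere. *)
Lemma quotF_ord (a : C) : exists k, ord quotF a k.
Proof.
apply: (@mero_ord R setT quotF (ofR 2) a) => //.
  by move=> z _; exact: quotF_mero.
move=> fl; have n2 := nbhs_dnbhsC (near_re_gt two_gt1).
have [z _ [z1 Fz]] := dnbhs_ex (dnbhs_filterS2 (fun _ => @conj _ _) n2 fl).
have := quotFE z1; rewrite Fz mul0r => /eqP; rewrite expf_eq0.
by rewrite (negbTE (zetaP_neq0 N_gt1 N_summable _ z1)) andbF.
Qed.

Lemma ord_prod0 (I : Type) (s : seq I) (Q : pred I) (F : I -> C -> C) a :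
  (forall i, Q i -> ord (F i) a 0) -> ord (fun z => \prod_(i <- s | Q i) F i z) a 0.
Proof.
move=> H; elim: s => [|i s IH].
  apply: (eq_ord (f := fun=> 1)).
    by apply/dnbhsCP; exists 1 => // z _ _; rewrite big_nil.
  by apply: hol_ord0; [exact: hol_cst|exact: oner_neq0].
case Qi: (Q i).
  have := ordM (H i Qi) IH; rewrite addr0; apply: eq_ord.
  by apply/dnbhsCP; exists 1 => // z _ _; rewrite big_cons Qi.
apply: (eq_ord _ IH).
by apply/dnbhsCP; exists 1 => // z _ _; rewrite big_cons Qi.
Qed.

(** The behaviour of the nontrivial L-functions on Re s = 1 enters here: they contribute order 0, so
    the order is that of the power of [zc]. *)
Lemma quotF_ord1 : ord quotF 1 (- (q.-1)%:Z).
Proof.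
have z1 := ordX q.-1 (pole_ord zc_pole).
have L1 : ord (fun s => \prod_(i | i != i0) Lc i s) 1 0.
  apply: ord_prod0 => i /Lc_cont[_ hL nL]; have r1 : re_ge 1 (1 : C) by exact: lexx.
  exact: (hol_ord0 (hL 1 r1) (nL 1 r1)).
by have := ordM z1 (ordV L1); rewrite oppr0 addr0 mulN1r.
Qed.

(** Unrolled: the product over [j < r] of [quotF] at [q ^ j s] to the power [q ^ (r - 1 - j)], times
    [zq] at [q ^ r s]. The last factor is in the half-plane of convergence exactly when Re s >
    q^-r. *)
Fixpoint tower (r : nat) (s : C) : C :=
  if r is m.+1 then quotF s ^+ (q ^ m) * tower m (q%:R * s) else zq s.

Lemma towerE r s : 1 < Re s -> tower r s = zq s ^+ (q ^ r).
Proof.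
elim: r s => [|r IH] s s1; first by rewrite expn0 expr1.
by rewrite /= IH ?Re_qM// -exprMn -quotFE// -exprM expnS.
Qed.

Lemma qr_gt0 r : 0 < (q ^ r)%:R :> R.
Proof. by rewrite ltr0n expn_gt0 prime_gt0. Qed.

Lemma q_neq0 : q%:R != 0 :> C.
Proof. by rewrite pnatr_eq0 -lt0n prime_gt0. Qed.

Lemma tower_mero r a : re_gt ((q ^ r)%:R^-1) a -> mero (tower r) a.
Proof.
elim: r a => [|r IH] a; rewrite /re_gt /=.
  rewrite expn0 invr1 => a1; exact/hol_mero/(zetaP_hol N_gt1 N_summable).
move=> ar; apply: (meroM (meroX (q ^ r) (quotF_mero a))).
apply: (mero_scale (f := tower r) q_neq0); apply: IH.
rewrite /re_gt /= Re_natM; move: ar; rewrite expnS natrM invfM.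
by rewrite mulrC ltr_pdivrMr ?q_gt0R// mulrC.
Qed.

Lemma qr_inv_le1 r : (q ^ r)%:R^-1 <= 1 :> R.
Proof. by rewrite invf_le1 ?qr_gt0// ler1n expn_gt0 prime_gt0. Qed.

Lemma tower_near r (a : C) : 1 < Re a ->
  \forall z \near a^', tower r z = zq z ^+ (q ^ r).
Proof.
by move=> /near_re_gt/nbhs_dnbhsC; apply: dnbhsC_S => z; exact: towerE.
Qed.

(** [tower] is computed pointwise and may have wrong values at removable singularities, which
    [meromorphic_on] does not allow; hence [regularize], which preserves the values where Re s >
    1. *)
Lemma tower_continuation r : meromorphic_continuation (re_gt 1)
  (re_gt ((q ^ r)%:R^-1)) (fun s => zq s ^+ (q ^ r)) (regularize (tower r)).
Proof.
split.
- by move=> s /=; apply: le_lt_trans; exact: qr_inv_le1.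
- exact/regularize_meromorphic/tower_mero.
- move=> s s1; apply: (regularizeE _ (tower_near r s1)).
  exact: (hol_continuous (holX (q ^ r)
    (zetaP_hol N_gt1 N_summable (Pord phi q) s1))).
Qed.

(** * The singular points q^-k *)

Definition qpt (k : nat) : C := (q%:R ^+ k)^-1.

Lemma qptE k : qpt k = ofR (q%:R ^+ k)^-1.
Proof. by rewrite /qpt ofRV -natrX -natrX ofR_nat. Qed.

(** Let e_j be the order of [quotF] at q^-j. The order at q^-k is the sum over j <= k of e_j
    q^(r-1-k+j), since the remaining factors are evaluated at real part > 1 and amount to a nonzero
    holomorphic power of [zq]. All terms with j > 0 are multiples of q^(r-k); the term j = 0 is
    -(q-1) q^(r-1-k) and is not. *)
Lemma tower_ord k r : (k < r)%N ->
  exists2 K : int, ord (tower r) (qpt k) K & ~~ ((q ^ (r - k))%:Z %| K)%Z.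
Proof.
elim: r k => // r IH [_|k kr].
  rewrite /qpt expr0 invr1 subn0.
  have c1 : 1 < Re (q%:R * 1 : C).
    by rewrite Re_natM /= mulr1 ltr1n prime_gt1.
  have o0 : ord (tower r) (q%:R * 1) 0.
    have h := holX (q ^ r) (zetaP_hol N_gt1 N_summable (Pord phi q) c1).
    have h0 : zq (q%:R * 1) ^+ (q ^ r) != 0.
      by rewrite expf_neq0// (zetaP_neq0 N_gt1 N_summable).
    apply: (eq_ord _ (hol_ord0 h h0)).
    by have := tower_near r c1; apply: dnbhsC_S => z ->.
  exists (- (q.-1)%:Z * (q ^ r)%:Z).
    have := ordM (ordX (q ^ r) quotF_ord1) (ord_scale q_neq0 o0).
    by rewrite addr0.
  (* After cancelling [q ^ r], divisibility would mean that [q] divides [q.-1], a positive number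
     below [q]. *)
  rewrite mulNr dvdzE abszN abszM !absz_nat expnS dvdn_pmul2r ?expn_gt0 ?prime_gt0//.
  rewrite gtnNdvd//; first by rewrite -subn1 subn_gt0 prime_gt1.
  by rewrite prednK// prime_gt0.
have [K oK nK] := IH k kr.
have [e oe] := quotF_ord (qpt k.+1).
have qk : q%:R * qpt k.+1 = qpt k.
  by rewrite /qpt exprS invfM mulrA divff ?mul1r// q_neq0.
exists (e * (q ^ r)%:Z + K).
  have oK' : ord (tower r) (q%:R * qpt k.+1) K by rewrite qk.
  exact: (ordM (ordX (q ^ r) oe) (ord_scale q_neq0 oK')).
(* The new term is a multiple of [q ^ r], hence of [q ^ (r - k)], and cannot restore
   divisibility. *)
rewrite subSS rpredDl//; apply: dvdz_mull.
by rewrite dvdzE !absz_nat dvdn_exp2l// leq_subr.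
Qed.

(** The identity principle on the half-plane, started at 2, replaces the given [M r] by [tower r]. A
    holomorphic root [g] is then either flat, which the existence of an order excludes, or its power
    has an order divisible by [q ^ r], against [tower_ord]. *)
Lemma qpt_singular (M : nat -> C -> C) : (forall r : nat, (1 <= r)%N ->
    meromorphic_continuation (re_gt 1) (re_gt ((q ^ r)%:R^-1))
      (fun s => zq s ^+ (q ^ r)) (M r)) ->
  forall k, singular_point q M (qpt k).
Proof.
move=> HM k; have Rek : Re (qpt k) = (q ^ k)%:R^-1 by rewrite qptE /= natrX.
split; first by rewrite Rek invr_gt0 qr_gt0.
move=> r r1; rewrite /re_gt /= => rk [g [hg gM]].
have kr : (k < r)%N.
  move: rk; rewrite Rek ltf_pV2 ?posrE ?qr_gt0// ltr_nat.
  by rewrite ltn_exp2l// prime_gt1.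
have [sub mM ME] := HM r r1.
have two2 : re_gt 1 (ofR 2 : C) by rewrite /re_gt /=; lra.
have E : \forall z \near (qpt k)^', M r z = tower r z.
  apply: (@mero_eq R (re_gt ((q ^ r)%:R^-1)) (M r) (tower r) (ofR 2)).
  - exact: segment_closed_re_gt.
  - by move=> z; exact: meromorphic_mero.
  - exact: tower_mero.
  - exact: sub.
  - exact: rk.
  - have := nbhs_dnbhsC (near_re_gt two_gt1); apply: dnbhsC_S => z z1.
    by rewrite ME// towerE.
have gT' := dnbhs_filterS2 (fun z (a : g z ^+ (q ^ r) = M r z) b =>
  etrans a b) gM E.
have [K oK /negP nK] := tower_ord kr.
have oK' : ord (fun z => g z ^+ (q ^ r)) (qpt k) K.
  by apply: (eq_ord _ oK); apply: (dnbhsC_S _ gT') => z ->.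
have [fg|[m om]] := meroP (hol_mero hg).
  apply: (ord_not_flat oK'); apply: (dnbhsC_S _ fg) => z ->.
  by rewrite expr0n gtn_eqF// expn_gt0 prime_gt0.
have KE := ord_uniq oK' (ordX (q ^ r) om).
apply: nK; rewrite KE; apply: dvdz_mull.
by rewrite dvdzE !absz_nat dvdn_exp2l// leq_subr.
Qed.

(** The points q^-(n+k) are distinct and, for a suitable [n], all lie in [U]; the bound [2 <= q]
    gives the decay. *)
Lemma qpt_infinite (A U : set C) : (forall k, A (qpt k)) -> nbhs (0 : C) U ->
  infinite_set (U `&` A).
Proof.
move=> HA /nbhsCP[d d0 HU] fin.
have [n Hn] := ex_small_pow 1 d0.
have small k : U (qpt (n + k)).
  apply: HU; rewrite subr0 qptE nrm_ofR ger0_norm; last first.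
    by rewrite invr_ge0 exprn_ge0// ler0n.
  apply: le_lt_trans Hn; rewrite div1r lef_pV2 ?posrE ?exprn_gt0 ?q_gt0R//.
  apply: (@le_trans _ _ (q%:R ^+ n)).
    by apply: lerXn2r; rewrite ?nnegrE ?ler0n// ler_nat prime_gt1.
  by rewrite exprD ler_peMr ?exprn_ge0 ?ler0n// exprn_ege1// q_ge1R.
have inj : injective (fun k => qpt (n + k)).
  move=> j k /eqP; rewrite !qptE (inj_eq (@ofR_inj R)) (inj_eq invr_inj).
  rewrite -!natrX eqr_nat eqn_exp2l ?prime_gt1// eqn_add2l => /eqP.
  by [].
have := finite_preimage (f := fun k => qpt (n + k)) (in2W inj) fin.
have -> : (fun k => qpt (n + k)) @^-1` (U `&` A) = setT.
  by apply/seteqP; split=> // k _; split.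
exact: infinite_nat.
Qed.

End MainArgument.

Theorem theorem1 (R : realType)
  (P : countType) (P_infinite : infinite_set [set: P])
  (N : P -> R) (N_gt1 : forall p, 1 < N p)
  (N_summable : exists d : R, 0 < d /\
    (\esum_(p in [set: P]) (N p `^ (- d))%:E < +oo)%E)
  (N_normalized : inf [set d : R | 0 < d /\
    (\esum_(p in [set: P]) (N p `^ (- d))%:E < +oo)%E] = 1)
  (zeta_holo : holomorphic_on (re_gt 1) (zetaP N [set: P]))
  (zeta_neq0 : nonvanishing_on (re_gt 1) (zetaP N [set: P]))
  (zeta_continuation : exists zc : Cplx R -> Cplx R,
    meromorphic_continuation (re_gt 1) [set: Cplx R] (zetaP N [set: P]) zc /\
    simple_pole zc 1)
  (q : nat) (q_prime : prime q)
  (gT : finGroupType) (G : {group gT}) (G_cyclic : cyclic G) (G_card : #|G| = q)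
  (Ghat : unitary_dual R G)
  (phi : P -> Conj G)
  (L_continuation : forall i : Ghat, ~ trivial_repr (urepr i) ->
    exists Lc : Cplx R -> Cplx R,
    [/\ meromorphic_continuation (re_gt 1) [set: Cplx R] (LP N phi (urepr i)) Lc,
        holomorphic_on (re_ge 1) Lc & nonvanishing_on (re_ge 1) Lc]) :
  [/\ forall s : Cplx R, 1 < complex.Re s ->
        zetaP N (Pord phi q) s ^+ q / zetaP N (Pord phi q) (q%:R * s)
        = zetaP N [set: P] s ^+ q / ZP N phi Ghat s,
      forall r : nat, (1 <= r)%N -> exists M : Cplx R -> Cplx R,
        meromorphic_continuation (re_gt 1) (re_gt ((q ^ r)%:R^-1))
          (fun s => zetaP N (Pord phi q) s ^+ (q ^ r)) M
    & forall M : nat -> Cplx R -> Cplx R,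
        (forall r : nat, (1 <= r)%N ->
          meromorphic_continuation (re_gt 1) (re_gt ((q ^ r)%:R^-1))
            (fun s => zetaP N (Pord phi q) s ^+ (q ^ r)) (M r)) ->
        forall U : set (Cplx R), nbhs (0 : Cplx R) U ->
          infinite_set (U `&` singular_point q M)].
Proof.
have sN := abscissa_summable N_gt1 N_summable N_normalized.
have [zc [zcc zcp]] := zeta_continuation.
have [i0 [_ i0c i0n]] := ex_trivial Ghat G_cyclic.
have /choice[Lc HLc] : forall i : Ghat, exists Lc : Cplx R -> Cplx R, i != i0 ->
    [/\ meromorphic_continuation (re_gt 1) [set: Cplx R] (LP N phi (urepr i)) Lc,
        holomorphic_on (re_ge 1) Lc & nonvanishing_on (re_ge 1) Lc].
  (* At [i0] any function will do: the product in [quotF] omits this index. *)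
  move=> i; have [->|ii] := eqVneq i i0; first by exists (fun=> 0).
  by have [Lc H] := L_continuation i (i0n i ii); exists Lc.
split.
- by move=> s s1; apply: euler_identity.
- move=> r _; exists (regularize (tower N q phi zc Lc i0 r)).
  exact: tower_continuation.
- move=> M HM U U0; apply: (qpt_infinite q_prime _ U0).
  exact: (qpt_singular N_gt1 sN q_prime G_cyclic G_card zcc zcp i0c HLc HM).
Qed.
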